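(* Let $l=2$. Fix an integer $0\le K\le\binom{m}{2}$, and consider the set $\{U\}_K$ of Schubert unions in $G(2,m)$ with spanning dimension $K$. Let $U_1$ and $U_2$ be the maximal and minimal elements of $\{U\}_K$ with respect to $M_U$. Then $U_1$ or $U_2$ is maximal in $\{U\}_K$ with respect to $g_U$. Furthermore, the one(s) among $U_1,U_2$ that is (are) maximal with respect to $g_U$ also has (have) the maximum number of points over $F_q$, among the elements of $\{U\}_K$, for all large enough $q$.
   Context: Let $V$ be an $m$-dimensional vector space ($m\ge3$) with basis $e_1,\dots,e_m$ and $A_i=\mathrm{Span}(e_1,\dots,e_i)$; $G(2,m)$ is the Grassmann variety of $2$-dimensional subspaces of $V$ in its Plücker embedding. Let $G_{G(2,m)}=\{(x,y)\in\mathbf Z^2:1\le x<y\le m\}$. For $(a,b)\in G_{G(2,m)}$ the Schubert cycle is $S_{(a,b)}=\{W:\dim(W\cap A_a)\ge1,\ W\subset A_b\}$, with grid $G_{(a,b)}=\{(x,y)\in G_{G(2,m)}:x\le a,y\le b\}$. A Schubert union $U=S_U$ is a finite (possibly empty) union of Schubert cycles $S_{\alpha_i}$, with grid $G_U=\bigcup_iG_{\alpha_i}$. Its spanning dimension is the dimension of the linear span of its affine cone, and equals the cardinality of $G_U$. Its number of points over $F_q$ is $g_U(q)=\sum_{(x,y)\in G_U}q^{x+y-3}$, regarded as a polynomial in $q$. $M_U=\{m_1,\dots,m_r\}\subset\{1,\dots,m-1\}$, where $m_i\ge1$ is the number of points of $G_U$ with $x=i$ for $i=1,\dots,r$, and there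 are no points of $G_U$ with $x>r$; then $m_1>m_2>\dots>m_r$. Order with respect to $g_U$ on $\{U\}_K$: $U>V$ if $\deg g_U>\deg g_V$, or if $\deg g_U=\deg g_V$ and the coefficient of $g_U$ is larger than that of $g_V$ in the largest degree where the coefficients differ (ties when $g_U=g_V$ are possible). Order with respect to $M_U$ on $\{U\}_K$: $U>V$ if the largest element of $M_U$ is larger than that of $M_V$, or if these are equal and the second largest element of $M_U$ is larger than that of $M_V$, and so on. *)

(* Defs.v *)
From HB Require Import structures.
From mathcomp Require Import all_boot all_order all_algebra.
Set Implicit Arguments.
Unset Strict Implicit.
Unset Printing Implicit Defensive.
Import Order.TTheory GRing.Theory Num.Theory.
Local Open Scope ring_scope.

(* Pairs (x, y) are 1-based: they live in {0, ..., m} x {0, ..., m}, and the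
   condition 1 <= x < y discards the index 0. *)
Definition grid (m : nat) : {set 'I_m.+1 * 'I_m.+1} :=
  [set p : 'I_m.+1 * 'I_m.+1 | (1 <= p.1 < p.2)%N].

Definition cycle_grid (m : nat) (ab : 'I_m.+1 * 'I_m.+1) :
    {set 'I_m.+1 * 'I_m.+1} :=
  [set p in grid m | (p.1 <= ab.1)%N && (p.2 <= ab.2)%N].

(* A Schubert union is given by the finite set U of the indices alpha_i of its
   Schubert cycles, which makes sense over all fields at once; only
   U \subset grid m is meaningful. Distinct U may define the same union. *)
Definition union_grid (m : nat) (U : {set 'I_m.+1 * 'I_m.+1}) :
    {set 'I_m.+1 * 'I_m.+1} :=
  \bigcup_(ab in U) cycle_grid ab.

Section Geometry.
Variables (F : fieldType) (V : vectType F) (m : nat) (e : m.-tuple V).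

Definition flag (i : nat) : {vspace V} := <<take i e>>%VS.

Definition schubert_cycle (ab : 'I_m.+1 * 'I_m.+1) (W : {vspace V}) : bool :=
  [&& \dim W == 2%N, (1 <= \dim (W :&: flag ab.1))%N & (W <= flag ab.2)%VS].

Definition schubert_union (U : {set 'I_m.+1 * 'I_m.+1}) (W : {vspace V}) :
    bool :=
  [exists ab in U, schubert_cycle ab W].

(* The second exterior power of V is realised as the space of alternating
   m x m matrices, e_i /\ e_j (i < j) being E_ij - E_ji: the entries i < j are
   the Pluecker coordinates. *)
Definition wedge (u v : V) : 'M[F]_m :=
  \matrix_(i, j) (coord e i u * coord e j v - coord e j u * coord e i v).

(* For \dim W = 2, the vectors wedge u v with u, v in W form exactly the line
   representing W in the Pluecker embedding. *)
Definition affine_cone (U : {set 'I_m.+1 * 'I_m.+1}) (w : 'M[F]_m) : Prop :=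
  exists2 W : {vspace V}, schubert_union U W &
  exists u v : V, [/\ u \in W, v \in W & w = wedge u v].

Definition is_linear_span (T : vectType F) (S : T -> Prop) (L : {vspace T}) :
    Prop :=
  (forall w, S w -> w \in L) /\
  (forall L' : {vspace T}, (forall w, S w -> w \in L') -> (L <= L')%VS).

Definition has_spanning_dim (U : {set 'I_m.+1 * 'I_m.+1}) (K : nat) : Prop :=
  exists2 L : {vspace 'M[F]_m}, is_linear_span (affine_cone U) L & \dim L = K.

Definition in_unions (K : nat) (U : {set 'I_m.+1 * 'I_m.+1}) : Prop :=
  U \subset grid m /\ has_spanning_dim U K.

End Geometry.

(* The subType structure of {vspace V} is only visible through this Import. *)
Import VectorInternalTheory.
HB.instance Definition _ (F : finFieldType) (V : vectType F) :=
  [Countable of (@space F V) by <:].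
HB.instance Definition _ (F : finFieldType) (V : vectType F) :=
  [Finite of (@space F V) by <:].

Definition npoints (F : finFieldType) (V : vectType F) (m : nat)
    (e : m.-tuple V) (U : {set 'I_m.+1 * 'I_m.+1}) : nat :=
  #|[set W : {vspace V} | schubert_union e U W]|.

(* x + y >= 3 on the grid, so the truncated subtraction is exact. *)
Definition gpoly (m : nat) (U : {set 'I_m.+1 * 'I_m.+1}) : {poly int} :=
  \sum_(p in union_grid U) 'X^(p.1 + p.2 - 3).

Definition gt_g (m : nat) (U V : {set 'I_m.+1 * 'I_m.+1}) : Prop :=
  (size (gpoly V) < size (gpoly U))%N \/
  size (gpoly U) = size (gpoly V) /\
  exists d : nat, (gpoly V)`_d < (gpoly U)`_d /\
    forall d' : nat, (d < d')%N -> (gpoly U)`_d' = (gpoly V)`_d'.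

Definition col_size (m : nat) (U : {set 'I_m.+1 * 'I_m.+1}) (i : nat) : nat :=
  #|[set p in union_grid U | p.1 == i :> nat]|.

(* All column sizes are at most m - 1, so 'I_m holds all elements of M_U. *)
Definition Mset (m : nat) (U : {set 'I_m.+1 * 'I_m.+1}) : {set 'I_m} :=
  [set k : 'I_m | (1 <= k)%N &
     [exists i : 'I_m.+1, (1 <= i)%N && (col_size U i == k)]].

Definition Mseq (m : nat) (U : {set 'I_m.+1 * 'I_m.+1}) : seq nat :=
  sort geq [seq val k | k in Mset U].

(* The default 0 of nth stands for a missing element, below all elements of
   an M_V. *)
Definition gt_M (m : nat) (U V : {set 'I_m.+1 * 'I_m.+1}) : Prop :=
  exists k : nat, (nth 0 (Mseq V) k < nth 0 (Mseq U) k)%N /\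
    forall j : nat, (j < k)%N -> nth 0%N (Mseq U) j = nth 0%N (Mseq V) j.

Definition maximal_in (T : Type) (P : T -> Prop) (gt : T -> T -> Prop) (x : T) :
    Prop :=
  P x /\ forall y, P y -> ~ gt y x.

Definition minimal_in (T : Type) (P : T -> Prop) (gt : T -> T -> Prop) (x : T) :
    Prop :=
  P x /\ forall y, P y -> ~ gt x y.

(* Main.v *)
Require Import Defs.
From mathcomp Require Import all_boot all_order all_algebra.
From mathcomp Require Import zify ring.
Set Implicit Arguments.
Unset Strict Implicit.
Unset Printing Implicit Defensive.
Import Order.TTheory GRing.Theory Num.Theory.

(** A Schubert union only depends on its grid, a shape whose columns have sizes
    m_1 > m_2 > ... > m_r; conversely each strictly decreasing sequence of
    positive integers below m arises. Both invariants at stake are read off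
    this strict partition. The span of the affine cone is the space of
    alternating matrices supported on the grid (cone_spanP), so that the
    spanning dimension K is the size of the grid, the sum of the m_i. Reduced
    echelon forms of 2 x m matrices give q^(x+y-3) points for each point (x,y)
    of the grid (npointsE), so that the number of points over F_q is the sum
    over i of q^(2i) (1 + q + ... + q^(m_(i+1) - 1)), called the weight. As the
    coefficients of g_U are bounded in terms of m, comparing g_U and g_V is the
    same as comparing the numbers of points for a single large q (gt_gP). Both
    claims therefore follow from a statement on strict partitions of K with
    parts at most N = m - 1: for q >= 3, the weight is maximal at the
    lexicographically largest one (greedy) or at the lexicographically smallest
    one (frugal). This is partition_bound.

    Behind it is a concavity phenomenon: the larger the antidiagonal x + y = s
    that a cell lies on, the more it weighs, and for a given s the cheapest way
    to reach that antidiagonal is one of the two extreme shapes. The proof uses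
    explicit moves. A run of v cells on consecutive antidiagonals, which is
    either the end of one part or the last cells of v consecutive parts
    a + v, ..., a + 1, moves to another place where it again forms a run; the
    weight does not decrease if the new run ends at least as far out (run_leq).

    The induction on N either removes a first part equal to N, or passes to the
    bound N - 1. It leaves two explicit comparisons: a frugal partition preceded
    by a full part (full_head_bound), and a greedy partition for the smaller
    bound (greedy_bound). These have at most three blocks of consecutive parts,
    and moves of runs lead from them to the greedy or to the frugal partition;
    outside the reach of such moves, crude estimates of the weight by a power
    of q decide in favour of the greedy one. *)

(** * Strict partitions and their two lexicographic extremes *)

(** The parts a + n, ..., a + 1, largest first. Counting from above a number a
    keeps all the surgery on blocks free of subtractions. *)
Fixpoint block (a n : nat) : seq nat :=
  if n is n'.+1 then (a + n) :: block a n' else [::].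

Lemma size_block a n : size (block a n) = n.
Proof. by elim: n => //= n ->. Qed.

Lemma block_cat a n1 n2 : block a (n1 + n2) = block (a + n2) n1 ++ block a n2.
Proof. by elim: n1 => //= n1 ->; congr (_ :: _); lia. Qed.

Lemma block_last a n : block a n.+1 = block a.+1 n ++ [:: a.+1].
Proof. by rewrite -addn1 block_cat /= addn1. Qed.

Lemma sumn_block_incr a n : sumn (block a.+1 n) = sumn (block a n) + n.
Proof. by elim: n => //= n ->; lia. Qed.

Definition triangle (n : nat) : nat := sumn (block 0 n).

Lemma triangleS n : triangle n.+1 = n.+1 + triangle n.
Proof. by []. Qed.

Lemma leq_triangle n : n <= triangle n.
Proof. by elim: n => // n IH; rewrite triangleS; lia. Qed.

Lemma leq_triangle2 m n : m <= n -> triangle m <= triangle n.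
Proof.
move=> /subnK <-; elim: (n - m) => // k IH.
by rewrite addSn triangleS; lia.
Qed.

Definition strict_partition (N K : nat) (s : seq nat) : bool :=
  [&& path gtn N.+1 s, all (ltn 0) s & sumn s == K].

Lemma strict_cons N K a s : strict_partition N K (a :: s) ->
  [/\ 0 < a <= N, a <= K & strict_partition a.-1 (K - a) s].
Proof.
rewrite /strict_partition /= => /and3P[/andP[aN ps] /andP[a0 s0] /eqP <-].
split; [lia|lia|].
by rewrite prednK // ps s0 addKn eqxx.
Qed.

Lemma strict_head_lt N K a s : a <= N -> strict_partition N.+1 K (a :: s) ->
  strict_partition N K (a :: s).
Proof.
move=> aN; rewrite /strict_partition /= => /and3P[/andP[_ ->] -> ->].
by rewrite andbT; lia.
Qed.

Lemma consK_strict N K s : strict_partition N (K - N.+1) s -> N < K ->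
  strict_partition N.+1 K (N.+1 :: s).
Proof.
rewrite /strict_partition /= => /and3P[-> -> /eqP ->] NK.
by rewrite leqnn; apply/eqP; lia.
Qed.

Lemma strict_widen N K s : strict_partition N K s -> strict_partition N.+1 K s.
Proof.
rewrite /strict_partition => /and3P[ps -> ->]; rewrite !andbT.
by case: s ps => //= a s /andP[aN ->]; rewrite andbT; lia.
Qed.

Lemma strict_leq N K s : strict_partition N K s -> K <= triangle N.
Proof.
elim: N K s => [|N IH] K [|a s].
- by rewrite /strict_partition /= => /eqP <-.
- by case/strict_cons; lia.
- by rewrite /strict_partition /= => /eqP <-.
move=> sp; rewrite triangleS; have [aN aK sp'] := strict_cons sp.
have [aN1|aN1] := leqP a N.
  by have := IH _ _ (strict_head_lt aN1 sp); lia.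
have aE : a = N.+1 by lia.
by move: sp'; rewrite aE /= => /IH; lia.
Qed.

(** Take N as soon as the sum K allows it: for K <= triangle N this is the
    lexicographically largest strict partition of K with parts at most N. *)
Fixpoint greedy (N K : nat) : seq nat :=
  if N is N'.+1 then
    if N <= K then N :: greedy N' (K - N) else greedy N' K
  else [::].

(** Take N only if the parts below N do not suffice: for K <= triangle N this is
    the lexicographically smallest strict partition of K. *)
Fixpoint frugal (N K : nat) : seq nat :=
  if N is N'.+1 then
    if K <= triangle N' then frugal N' K else N :: frugal N' (K - N)
  else [::].

Lemma greedy_strict N K : K <= triangle N -> strict_partition N K (greedy N K).
Proof.
elim: N K => [|N IH] K; first by case: K.
rewrite triangleS /= => KN; have := leq_triangle N.
case: ifP => NK TN; first by apply: consK_strict => //; apply: IH; lia.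
by apply: strict_widen; apply: IH; lia.
Qed.

Lemma frugal_strict N K : K <= triangle N -> strict_partition N K (frugal N K).
Proof.
elim: N K => [|N IH] K; first by case: K.
rewrite triangleS /= => KN; have := leq_triangle N.
case: ifP => NK TN; first by apply: strict_widen; apply: IH.
by apply: consK_strict; [apply: IH|]; lia.
Qed.

(** Missing entries count as 0, below all parts. *)
Definition lexgt (s t : seq nat) : Prop :=
  exists k, nth 0 t k < nth 0 s k /\ forall j, j < k -> nth 0 s j = nth 0 t j.

Lemma lexgt_cons a s t : lexgt s t -> lexgt (a :: s) (a :: t).
Proof. by case=> k [lt eq]; exists k.+1; split=> // -[|j] //= /eq. Qed.

Lemma strict_head N K s : strict_partition N K s -> nth 0 s 0 <= N.
Proof. by case: s => [|a s] sp /=; [|case: (strict_cons sp)]; lia. Qed.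

Lemma strictS_cases N K s : strict_partition N.+1 K s ->
  strict_partition N K s \/
  exists2 s', s = N.+1 :: s' & N < K /\ strict_partition N (K - N.+1) s'.
Proof.
case: s => [|a s] sp; first by left.
have [aN aK sp'] := strict_cons sp.
have [aN1|aN1] := leqP a N; first by left; apply: strict_head_lt.
have aE : a = N.+1 by lia.
by right; exists s; rewrite aE // in aK sp' *.
Qed.

Lemma greedy_max N K s : strict_partition N K s ->
  s = greedy N K \/ lexgt (greedy N K) s.
Proof.
elim: N K s => [|N IH] K s.
  by case: s => [|a s]; [left|case/strict_cons; lia].
case/strictS_cases => [sp|[s' -> [NK sp]]] /=.
  case: ifP => NK; last exact: IH.
  by right; exists 0; split=> //=; have := strict_head sp; lia.
rewrite NK; case: (IH _ _ sp) => [->|lt]; first by left.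
by right; apply: lexgt_cons.
Qed.

Lemma frugal_min N K s : strict_partition N K s ->
  s = frugal N K \/ lexgt s (frugal N K).
Proof.
elim: N K s => [|N IH] K s.
  by case: s => [|a s]; [left|case/strict_cons; lia].
case/strictS_cases => [sp|[s' -> [NK sp]]] /=.
  by rewrite (strict_leq sp); apply: IH.
case: ifP => KT.
  by right; exists 0; split=> //=; have := strict_head (frugal_strict KT); lia.
case: (IH _ _ sp) => [->|lt]; first by left.
by right; apply: lexgt_cons.
Qed.

(** The bound N is immaterial once it is large enough for K, as it only limits
    how large the parts may be. This allows K itself as a uniform bound. *)
Lemma frugal_stable N K : K <= triangle N -> frugal N K = frugal K K.
Proof.
have widen M n : K <= triangle M -> frugal (n + M) K = frugal M K.
  move=> KM; elim: n => // n IH; rewrite addSn /= IH.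
  by rewrite (leq_trans KM) // leq_triangle2 // leq_addl.
by move=> KN; rewrite -(widen _ K KN) addnC widen // leq_triangle.
Qed.

Lemma frugalS N K : frugal N.+1 K =
  if K <= triangle N then frugal N K else N.+1 :: frugal N (K - N.+1).
Proof. by []. Qed.

(** Frugal partitions are the full staircases with one part u + 1 removed: the
    staircase is the first one of sum larger than K, and u + 1 is the excess.
    For n = 0 the removed part is the largest one. *)
Lemma frugal_block u n K : K + u.+1 = triangle (u + n).+1 ->
  frugal (u + n).+1 K = block u.+1 n ++ block 0 u.
Proof.
elim: n K => [|n IH] K.
  rewrite addn0 triangleS => KE; have -> /= : K = triangle u by lia.
  rewrite leqnn; elim: u {KE} => //= u {1}<-; rewrite triangleS.
  by rewrite addKn -[X in _ <= X]add0n leq_add2r.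
rewrite triangleS => KE; rewrite frugalS ifF; last by lia.
rewrite (addnS u n) in KE *; rewrite IH; last first.
  by have := leq_triangle (u + n).+1; lia.
by congr (_ :: _); lia.
Qed.

(** * Weights, and moving runs of cells *)

Section Weight.
Variable q : nat.
Hypothesis q3 : 2 < q.

(** (q^n - 1) / (q - 1): the weight of n cells on consecutive antidiagonals, the
    first one having weight 1. *)
Definition geo (n : nat) : nat := \sum_(i < n) q ^ i.

(** The next column of the grid starts two antidiagonals further out, whence the
    factor q^2. *)
Fixpoint weight (s : seq nat) : nat :=
  if s is a :: s' then geo a + q ^ 2 * weight s' else 0.

Lemma geo0 : geo 0 = 0.
Proof. by rewrite /geo big_ord0. Qed.

Lemma geoSr n : geo n.+1 = geo n + q ^ n.
Proof. by rewrite /geo big_ord_recr. Qed.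

Lemma geo_add a b : geo (a + b) = geo a + q ^ a * geo b.
Proof.
elim: b => [|b IH]; first by rewrite addn0 geo0 muln0 addn0.
by rewrite addnS !geoSr IH expnD; ring.
Qed.

Lemma geoS n : geo n.+1 = 1 + q * geo n.
Proof. by rewrite -add1n geo_add expn1 geoSr geo0. Qed.

Lemma weight_cat s t : weight (s ++ t) = weight s + q ^ (2 * size s) * weight t.
Proof.
elim: s => [|a s IH] /=; first by rewrite muln0 mul1n.
by rewrite IH mulnS expnD; ring.
Qed.

(** The n cells added to the parts of a block form a run: each part is one
    shorter than the previous one, but starts two antidiagonals further out. *)
Lemma weight_block_incr a n :
  weight (block a.+1 n) = weight (block a n) + q ^ (a + n) * geo n.
Proof.
elim: n => [|n IH]; first by rewrite geo0 muln0.
rewrite /= IH addSn geoSr geoS addnS expnS; ring.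
Qed.

Lemma weight_block0S u :
  weight (block 0 u.+1) = weight (block 0 u) + q ^ u * geo u.+1.
Proof.
elim: u => [|u IH]; first by rewrite /= mul1n muln0 addn0.
have HS n : weight (block 0 n.+1) = geo n.+1 + q ^ 2 * weight (block 0 n) by [].
rewrite HS {1}IH HS [geo u.+2 in LHS]geoSr [geo u.+2]geoS expnS; ring.
Qed.

(** No cell of such a partition weighs more than q^(2(u+n)-1). The summand
    q^(u+n) makes the induction work, for q >= 3. *)
Lemma weight_stair_bound n u :
  weight (block u.+1 n ++ block 0 u) + q ^ (u + n) <= q ^ (2 * (u + n)).
Proof.
have geo_bound k : geo k + 1 <= q ^ k.
  by elim: k => [|k IH]; rewrite ?geo0 // geoSr expnS; nia.
have scale k x y : x + q ^ k <= y -> q ^ 2 * x + 3 * q ^ k.+1 <= q ^ 2 * y.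
  move=> le; have := leq_mul (leqnn (q ^ 2)) le.
  have := leq_mul q3 (leqnn (q ^ k.+1)); rewrite !expnS expn0; lia.
have: weight (block 0 u) + q ^ u <= q ^ (2 * u).
  elim: u => [|u /scale IH] //; rewrite mulnS [q ^ (2 + _)]expnD /= add0n geoSr.
  have := geo_bound u; have := leq_mul (ltnW q3) (leqnn (q ^ u)).
  by rewrite !expnS in IH *; lia.
elim: n => [|n IH] Hu; first by rewrite addn0.
have {IH}/scale := IH Hu.
rewrite addnS /= mulnS [q ^ (2 + _)]expnD addSn addnS geoSr.
by have := geo_bound (u + n).+1; lia.
Qed.

(** The right-hand side is the weight of the single part K. Concatenating all
    parts into one does not decrease the weight: a second part is shifted by a
    instead of 2 antidiagonals, and a >= 2 because a is not the smallest part. *)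
Lemma weight_le_geo N K s : strict_partition N K s -> weight s <= geo K.
Proof.
elim: s N K => // a s IH N K /strict_cons[aN aK sp].
have {}IH := IH _ _ sp; rewrite -(subnKC aK) geo_add /=.
rewrite leq_add2l; case: s sp IH => [|b s] sp IH; first by rewrite muln0.
have [ba _ _] := strict_cons sp.
by apply: leq_mul => //; rewrite leq_exp2l //; lia.
Qed.

Lemma greedy_small N K : 0 < K <= N -> greedy N K = [:: K].
Proof.
elim: N => [|N IH] /=; first by lia.
move=> KN; case: ifP => NK; last by apply: IH; lia.
have -> : K = N.+1 by lia.
by rewrite subnn; congr (_ :: _); elim: N {IH KN NK}.
Qed.

(** By frugal_stable, the bound sumn s gives the same frugal partition as any
    other bound that is large enough. *)
Definition below_frugal (s : seq nat) : Prop :=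
  weight s <= weight (frugal (sumn s) (sumn s)).

Lemma sumn_frugal_block u n :
  sumn (block u.+1 n ++ block 0 u) + u.+1 = triangle (u + n).+1.
Proof.
rewrite sumn_cat; elim: n => [|n IH]; first by rewrite addn0 /triangle /=; lia.
by rewrite (addnS u n) triangleS -IH /=; lia.
Qed.

Lemma below_frugal_stair s u n : sumn s = sumn (block u.+1 n ++ block 0 u) ->
  weight s <= weight (block u.+1 n ++ block 0 u) -> below_frugal s.
Proof.
rewrite /below_frugal => -> le.
rewrite -(@frugal_stable (u + n).+1); last by rewrite -sumn_frugal_block; lia.
by rewrite frugal_block // sumn_frugal_block.
Qed.

Lemma below_frugal_trans s t : sumn s = sumn t -> weight s <= weight t ->
  below_frugal t -> below_frugal s.
Proof. by rewrite /below_frugal => -> /leq_trans; apply. Qed.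

(** Both shapes arise from a common remainder of weight X by adding a run of v
    cells; the comparison only depends on where the runs start. *)
Lemma run_leq v a b X Y Z : Y = X + q ^ a * geo v -> Z = X + q ^ b * geo v ->
  a <= b -> Y <= Z.
Proof.
move=> -> -> ab; rewrite leq_add2l leq_mul2r leq_exp2l ?ab ?orbT //; lia.
Qed.

(** Consecutive parts p + 1, p + 2, ... with the single part p + v + 1 removed.
    The case p = 0 is frugal. The condition p <= v + w is what makes it
    profitable to close the gap by a new smallest part, see gaps_belowP. *)
Definition gaps_below (p : nat) : Prop := forall v w, p <= v + w ->
  below_frugal (block (p + v).+1 w ++ block p v).

(** A block followed by one smaller part r; r = 0 stands for no further part. *)
Definition stubs_below (c : nat) : Prop := forall j r, r < c -> c <= j ->
  below_frugal (block c j ++ [:: r]).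

(** Fill up the last part r to c - 1 with the v = c - 1 - r cells that are taken
    from the last v parts of the block. The two runs lie on the same
    antidiagonals, so the weight does not change, and the result is a block with
    a gap whose smallest part is c - 1. *)
Lemma stubs_below_of_gaps c : (forall p, p < c -> gaps_below p) -> stubs_below c.
Proof.
case: c => [|[|p]] gaps j r rc cj //.
  have -> : r = 0 by lia.
  by apply: (@below_frugal_stair _ 0 j);
    rewrite ?sumn_cat ?weight_cat /= ?geo0 ?muln0.
have [v vE] : exists v, p.+1 = r + v by exists (p.+1 - r); lia.
have [w wE] : exists w, j = w + v by exists (j - v); lia.
have Et : block (p + v.+1).+1 w ++ block p v.+1 =
          block (p + v.+1).+1 w ++ block p.+1 v ++ [:: p.+1].
  by rewrite block_last.
have Es : block p.+2 j ++ [:: r] =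
          block (p + v.+1).+1 w ++ block p.+2 v ++ [:: r].
  by rewrite wE block_cat -catA; congr (block _ _ ++ _ ++ _); lia.
have gap : below_frugal (block (p + v.+1).+1 w ++ block p v.+1).
  by apply: gaps; lia.
rewrite Es; rewrite Et in gap; apply: below_frugal_trans gap.
  by rewrite !sumn_cat /= (sumn_block_incr p.+1); lia.
rewrite !weight_cat !size_block /= (weight_block_incr p.+1) vE geo_add.
apply: (@run_leq v (2 * w + (r + v + v)) (2 * w + (2 * v + r))
  (weight (block (p + v.+1).+1 w) + q ^ (2 * w) * weight (block (r + v) v)
     + q ^ (2 * w) * q ^ (2 * v) * geo r)); rewrite ?expnD; [ring|ring|lia].
Qed.

(** Take one cell from each of the last parts above the gap, and use these cells
    for a new smallest part, of size at most p. If w >= p the new part is p, the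
    gap moves up by p places, and the shape has one more part. If w < p the gap
    disappears, and the new part w is a stub below the block p + 1, p + 2, .... *)
Lemma gaps_belowP p : gaps_below p.
Proof.
elim/ltn_ind: p => -[|p] IH v w vw; first exact: below_frugal_stair.
have [pw|wp] := leqP p.+1 w; last first.
  (* All w parts above the gap lose a cell, which closes the gap. *)
  have := @stubs_below_of_gaps p.+1 IH (v + w) w wp vw.
  rewrite addnC block_cat -catA => stub; apply: below_frugal_trans stub.
    by rewrite !sumn_cat /= sumn_block_incr; lia.
  rewrite !weight_cat !size_block /= weight_block_incr.
  apply: (@run_leq w (p.+1 + v + w) (2 * w + 2 * v)
    (weight (block (p.+1 + v) w) + q ^ (2 * w) * weight (block p.+1 v)));
    rewrite ?expnD; [ring|ring|lia].
(* Only the last p + 1 of the w parts above the gap lose a cell. *)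
have [w' wE] : exists w', w = w' + p.+1 by exists (w - p.+1); lia.
have gap : below_frugal (block (p + (v + p.+2)).+1 w' ++ block p (v + p.+2)).
  by apply: IH; lia.
have Et : block (p + (v + p.+2)).+1 w' ++ block p (v + p.+2) =
    block (p + (v + p.+2)).+1 w' ++ block (p + v).+1 p.+1 ++ block p.+1 v
      ++ [:: p.+1].
  by rewrite -block_last (_ : v + p.+2 = p.+1 + v.+1) ?block_cat ?addnS //; lia.
have Es : block (p.+1 + v).+1 w ++ block p.+1 v =
    block (p + (v + p.+2)).+1 w' ++ block (p + v).+2 p.+1 ++ block p.+1 v.
  by rewrite wE block_cat -catA; congr (block _ _ ++ _); lia.
rewrite Es; rewrite Et in gap; apply: below_frugal_trans gap.
  by rewrite !sumn_cat (sumn_block_incr (p + v).+1) [sumn [:: _]]/=; lia.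
rewrite !weight_cat !size_block (weight_block_incr (p + v).+1).
rewrite [weight [:: _]]/= muln0 addn0.
apply: (@run_leq p.+1 (2 * w' + ((p + v).+1 + p.+1))
    (2 * w' + (2 * p.+1 + 2 * v))
    (weight (block (p + (v + p.+2)).+1 w')
     + q ^ (2 * w') * weight (block (p + v).+1 p.+1)
     + q ^ (2 * w') * q ^ (2 * p.+1) * weight (block p.+1 v)));
  rewrite ?(expnD _ (2 * w')) ?(expnD _ (2 * p.+1)) ?(expnD _ _ p.+1);
  [ring|ring|lia].
Qed.

(** The excess v of the first part is spread over the first v parts below the
    gap. The first part is then consecutive to the others, and the gap has moved
    down by v places: this is a frugal partition. *)
Lemma near_head_below u n v : v <= u ->
  below_frugal (u + n + v.+2 :: block u.+1 n ++ block 0 u).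
Proof.
move=> /subnK; move: (u - v) => c cE.
have Es : u + n + v.+2 :: block u.+1 n ++ block 0 u =
    (c + v + n).+2 + v :: block (c + v).+1 n ++ block c v ++ block 0 c.
  by rewrite -cE [X in block 0 X]addnC block_cat addnC; congr (_ :: _); lia.
have Et : block c.+1 (n + v).+1 ++ block 0 c =
    (c + v + n).+2 :: block (c + v).+1 n ++ block c.+1 v ++ block 0 c.
  by rewrite /= block_cat -catA; congr (_ :: _); lia.
apply: (@below_frugal_stair _ c (n + v).+1); rewrite Es Et.
  by rewrite /= !sumn_cat (sumn_block_incr c); lia.
rewrite /= !weight_cat !size_block (weight_block_incr c) geo_add.
apply: (@run_leq v (c + v + n).+2 (2 + (2 * n + (c + v)))
  (geo (c + v + n).+2 + q ^ 2 * (weight (block (c + v).+1 n) + q ^ (2 * n) *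
   (weight (block c v) + q ^ (2 * v) * weight (block 0 c)))));
 [ring| |lia].
rewrite (expnD _ 2) (expnD _ (2 * n)); ring.
Qed.

(** If the excess of the first part is too large for near_head_below, it first
    fills the gap u + 1. This needs u + 1 cells, which become the last cells of
    the parts 1, ..., u + 1. After that there is a single staircase below the
    first part, and near_head_below applies to it. *)
Lemma tall_head_below u n M : u + n + 2 <= M <= 2 * (u + n) + 1 ->
  below_frugal (M :: block u.+1 n ++ block 0 u).
Proof.
move=> /andP[uM Mu].
have [Mn|Mn] := leqP M (2 * u + n + 2).
  have -> : M = u + n + (M - (u + n + 2)).+2 by lia.
  by apply: near_head_below; lia.
have [M' ME] : exists M', M = M' + u.+1 by exists (M - u.+1); lia.
have Et : M' :: block 0 (n + u.+1) = M' :: block u.+1 n ++ block 0 u.+1.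
  by rewrite block_cat.
apply: (@below_frugal_trans _ (M' :: block 0 (n + u.+1))).
- by rewrite Et ME /= !sumn_cat /= add0n; lia.
- rewrite Et ME [weight (_ :: _)]/= [weight (M' :: _)]/= !weight_cat.
  rewrite !size_block weight_block0S geo_add.
  apply: (@run_leq u.+1 M' (2 + (2 * n + u))
    (geo M' + q ^ 2 * (weight (block u.+1 n)
     + q ^ (2 * n) * weight (block 0 u))));
    [ring|rewrite (expnD _ 2) (expnD _ (2 * n)); ring|lia].
(* The new first part either continues the staircase or is larger still. *)
have [M2|M2] := leqP M' (n + u).+2.
  have -> : M' = (n + u.+1).+1 by lia.
  by apply: (@below_frugal_stair _ (n + u.+1).+1 0); rewrite /= add0n.
have -> : M' = n + u.+1 + 0 + (M' - (n + u.+3)).+2 by lia.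
by apply: (@near_head_below (n + u.+1) 0); lia.
Qed.

(** The alternative distinguishes the full staircase, whose largest part is u,
    from the staircases with a gap, whose largest part is u + n + 1. *)
Lemma frugal_shape N K : K <= triangle N ->
  exists u n, K + u.+1 = triangle (u + n).+1 /\ (n = 0 /\ u <= N \/ u + n < N).
Proof.
elim: N => [|N IH] KN.
  by exists 0, 0; split; [move: KN; rewrite leqn0 => /eqP -> | left].
have [KN'|KN'] := leqP K (triangle N).
  by have [u [n [E C]]] := IH KN'; exists u, n; split=> //; lia.
have [KE|KE] := eqVneq K (triangle N.+1).
  by exists N.+1, 0; split; [rewrite addn0 triangleS -KE addnC | left].
have := triangleS N => TE.
exists (triangle N.+1 - K).-1, (N - (triangle N.+1 - K).-1).
rewrite (_ : _ + (N - _) = N); last by lia.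
by split; [|right]; lia.
Qed.

(** If N is at most twice the height of the staircase, then lowering the first
    part leads to the frugal partition. Otherwise the remaining parts are better
    replaced by the greedy partition of K: either this is the single part K, or
    its first part N alone outweighs the staircase. *)
Lemma full_head_bound N K : K <= triangle N ->
  weight (N.+1 :: frugal N K) <=
  maxn (weight (greedy N.+1 (N.+1 + K))) (weight (frugal N.+1 (N.+1 + K))).
Proof.
move=> KN; have [u [n [E C]]] := frugal_shape KN.
have frugalE : frugal N K = block u.+1 n ++ block 0 u.
  rewrite frugal_stable // -(@frugal_stable (u + n).+1) ?frugal_block //; lia.
have below : below_frugal (N.+1 :: frugal N K) -> weight (N.+1 :: frugal N K) <=
  maxn (weight (greedy N.+1 (N.+1 + K))) (weight (frugal N.+1 (N.+1 + K))).
  have /and3P[_ _ /eqP sumE] := frugal_strict KN.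
  rewrite /below_frugal [sumn (_ :: _)]/= sumE => le.
  by rewrite (@frugal_stable N.+1) ?leq_max ?le ?orbT // triangleS leq_add2l.
have [Nbig|Nsmall] := leqP (2 * (u + n) + 1) N; last first.
  apply: below; rewrite frugalE.
  have [[n0 uE]|uN] : (n = 0 /\ u = N) \/ u + n < N by lia.
    by apply: (@below_frugal_stair _ N.+1 0); rewrite n0 uE /= add0n.
  by apply: tall_head_below; lia.
rewrite leq_max; apply/orP; left.
rewrite /= leq_addr addKn leq_add2l leq_mul2l; apply/orP; right.
have [KN'|KN'] := leqP K N.
  have [-> |K0] := posnP K.
    rewrite (_ : frugal N 0 = [::]) //.
    by elim: N {KN C frugalE below Nbig KN'}.
  rewrite greedy_small ?K0 // /= muln0 addn0.
  exact: weight_le_geo (frugal_strict KN).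
rewrite frugalE; apply: (@leq_trans (q ^ (2 * (u + n)))).
  by have := weight_stair_bound n u; lia.
case: N KN C frugalE below Nbig KN' => [|N] KN C frugalE below Nbig KN' /=.
  by lia.
rewrite (ltnW KN') /= geoSr -addnA.
apply: leq_trans (leq_trans (leq_addr _ _) (leq_addl _ _)).
by rewrite leq_exp2l; lia.
Qed.

(** Greedy partitions are a block of the j largest parts, followed by a rest r
    that is smaller than the next part c. *)
Lemma greedy_block c j r : r < c ->
  greedy (c + j) (sumn (block c j) + r) = block c j ++ greedy c r.
Proof.
move=> rc; elim: j => [|j IH]; first by rewrite addn0.
rewrite addnS /= addnS -addnA leq_addr -addSn addKn IH //.
Qed.

Lemma weight_greedy_block c j r : r < c ->
  weight (greedy (c + j) (sumn (block c j) + r)) = weight (block c j ++ [:: r]).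
Proof.
move=> rc; rewrite greedy_block // !weight_cat; congr (_ + _ * _).
have [-> |r0] := posnP r; last by rewrite greedy_small // r0 ltnW.
by rewrite /= geo0 muln0; elim: c {rc}.
Qed.

Lemma greedy_shape N K : K < triangle N ->
  exists c j r, [/\ r < c, N = c + j & K = sumn (block c j) + r].
Proof.
elim: N K => // N IH K; rewrite triangleS => KN.
have [NK|NK] := leqP N.+1 K; last by exists N.+1, 0, K; rewrite addn0.
have [|c [j [r [rc NE KE]]]] := IH (K - N.+1); first by lia.
by exists c, j.+1, r; rewrite addnS -NE; split=> //; move: KE; rewrite /=; lia.
Qed.

(** A greedy partition for the bound N is the block c + j, ..., c + 1 with a rest
    r < c. If r >= j, then one cell for each part of the block is taken from the
    rest. If r < j <= c, then the rest is spread over the first parts, and the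
    other parts of the block but the last receive cells from the end of the last
    one. Both lead to the greedy partition for N + 1. If j > c, the block is long
    and the frugal partition is better. *)
Lemma greedy_bound N K : K <= triangle N ->
  weight (greedy N K) <= maxn (weight (greedy N.+1 K)) (weight (frugal N.+1 K)).
Proof.
rewrite leq_eqVlt => /predU1P[->|KN].
  rewrite leq_max; apply/orP; right; rewrite frugalS leqnn.
  suff -> : greedy N (triangle N) = frugal N (triangle N) by [].
  elim: N => // N IH; rewrite frugalS triangleS /= leq_addr addKn IH.
  by rewrite -[X in _ <= X]add0n leq_add2r.
have /and3P[_ _ /eqP sumG] := greedy_strict (ltnW KN).
have below : below_frugal (greedy N K) ->
  weight (greedy N K) <= maxn (weight (greedy N.+1 K)) (weight (frugal N.+1 K)).
  rewrite /below_frugal sumG => le.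
  by rewrite frugalS (ltnW KN) (frugal_stable (ltnW KN)) leq_max le orbT.
have [c [j [r [rc NE KE]]]] := greedy_shape KN.
have [jr|rj] := leqP j r.
  rewrite leq_max; apply/orP; left.
  have {}KE' : K = sumn (block c.+1 j) + (r - j).
    by rewrite sumn_block_incr; lia.
  rewrite {2}KE' NE KE -addSn !weight_greedy_block //; last by lia.
  rewrite !weight_cat !size_block /= weight_block_incr -{1}(subnK jr) geo_add.
  apply: (@run_leq j (2 * j + (r - j)) (c + j)
    (weight (block c j) + q ^ (2 * j) * geo (r - j)));
    rewrite ?(expnD _ (2 * j)); [ring|ring|lia].
have [jc|cj] := leqP j c; last first.
  apply: below.
  have := @stubs_below_of_gaps c (fun p _ => @gaps_belowP p) j r rc (ltnW cj).
  apply: below_frugal_trans; last by rewrite NE KE weight_greedy_block.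
  by rewrite sumG sumn_cat /= addn0.
rewrite leq_max; apply/orP; left.
(* The block has r parts that take the rest, d parts that take a cell each from
   the last part, and the last part c + 1, of which e cells remain. *)
have [d jE] : exists d, j = r + d.+1 by exists (j - r.+1); lia.
have Es : block c j ++ [:: r] =
    block (c + d).+1 r ++ block c.+1 d ++ [:: c.+1] ++ [:: r].
  by rewrite jE block_cat block_last -!catA; congr (block _ _ ++ _); lia.
have [e ce] : exists e, c.+1 = e + d by exists (c.+1 - d); lia.
have Et : block c.+2 (r + d) ++ [:: e] =
    block (c + d).+2 r ++ block c.+2 d ++ [:: e].
  by rewrite block_cat -catA.
have KE' : K = sumn (block c.+2 (r + d)) + e.
  move: (congr1 sumn Es) (congr1 sumn Et).
  rewrite !sumn_cat (sumn_block_incr (c + d).+1) (sumn_block_incr c.+1 d) /=.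
  lia.
rewrite {2}KE' NE KE (_ : (c + j).+1 = c.+2 + (r + d)); last by lia.
rewrite !weight_greedy_block //; last by lia.
rewrite Es Et !weight_cat !size_block.
rewrite (weight_block_incr (c + d).+1) (weight_block_incr c.+1).
rewrite /= ce geo_add !muln0 !addn0 muln1.
apply: (@run_leq r (2 * r + (2 * d + 2)) ((c + d).+1 + r)
  (weight (block (c + d).+1 r) + q ^ (2 * r) * (weight (block (e + d) d) +
   q ^ (2 * d) * (geo e + q ^ e * geo d)))).
- by rewrite (expnD _ (2 * r)) (expnD _ (2 * d)); ring.
- by rewrite (_ : e + d + d = 2 * d + e) ?(expnD _ (2 * d)); [ring|lia].
by lia.
Qed.

(** Induction on N. A first part N can be split off as it is common to both
    sides, except that it turns a frugal remainder into a partition that is in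
    general not frugal. Without a part N, only the greedy partition changes with
    the bound. *)
Lemma partition_bound N K s : strict_partition N K s ->
  weight s <= maxn (weight (greedy N K)) (weight (frugal N K)).
Proof.
elim: N K s => [|N IH] K s sp.
  by case: s sp => // a s /strict_cons[]; lia.
case/strictS_cases: (sp) => [sp'|[s' -> [NK sp']]].
  have KN := strict_leq sp'; apply: leq_trans (IH _ _ sp') _.
  by rewrite geq_max greedy_bound // frugalS KN leq_maxr.
have KN := strict_leq sp'; have := IH _ _ sp'.
rewrite leq_max => /orP[le|le]; last first.
  have := full_head_bound KN; rewrite subnKC //; apply: leq_trans.
  by rewrite /= leq_add2l leq_mul2l le orbT.
rewrite leq_max; apply/orP; left.
by rewrite /= NK /= leq_add2l leq_mul2l le orbT.
Qed.

End Weight.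

(** * The grid of a Schubert union as a strict partition *)

Lemma card_ord_ltn m k : k <= m -> #|[pred i : 'I_m | i < k]| = k.
Proof.
by move=> km; rewrite -sum1_card (big_ord_narrow km) sum1_card card_ord.
Qed.

Lemma card_ord_interval m x z : (z <= m)%N ->
  #|[set y : 'I_m.+1 | x < y <= z]| = z - x.
Proof.
move=> zm; have [zx|xz] := leqP z x.
  rewrite (_ : _ - _ = 0); last by lia.
  by apply/eqP; rewrite cards_eq0; apply/eqP/setP=> y; rewrite !inE; lia.
have := cardID [pred y : 'I_m.+1 | y < x.+1] [pred y : 'I_m.+1 | y < z.+1].
rewrite (card_ord_ltn (_ : z.+1 <= m.+1)) //.
rewrite (_ : #|[predI _ & _]| = x.+1); last first.
  rewrite -[RHS](@card_ord_ltn m.+1); last by lia.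
  by apply: eq_card => y; rewrite !inE; lia.
rewrite (_ : #|[predD _ & _]| = #|[set y : 'I_m.+1 | x < y <= z]|); first lia.
by apply: eq_card => y; rewrite !inE; lia.
Qed.

Section Columns.
Variable m : nat.
Implicit Types (U : {set 'I_m.+1 * 'I_m.+1}) (p : 'I_m.+1 * 'I_m.+1).

Lemma union_gridP U p :
  reflect (exists2 ab, ab \in U & p \in cycle_grid ab) (p \in union_grid U).
Proof. exact: bigcupP. Qed.

Lemma union_grid_sub U p : p \in union_grid U -> p \in grid m.
Proof. by case/union_gridP=> ab _; rewrite inE => /andP[]. Qed.

Lemma union_grid_down U p p' : p \in union_grid U -> p' \in grid m ->
  p'.1 <= p.1 -> p'.2 <= p.2 -> p' \in union_grid U.
Proof.
move=> /union_gridP[ab abU]; rewrite inE => /and3P[_ pa pb] pG p1 p2.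
apply/union_gridP; exists ab; rewrite // inE pG.
by rewrite (leq_trans p1) // (leq_trans p2).
Qed.

Definition column U (x : 'I_m.+1) :=
  [set y : 'I_m.+1 | (x, y) \in union_grid U].

Lemma card_column U x : #|column U x| = col_size U x.
Proof.
rewrite -(@card_imset _ _ (pair x)); last by move=> y y' [].
apply: eq_card => p; apply/imsetP/idP => [[y yU ->]|].
  by rewrite !inE in yU *; rewrite yU /=.
rewrite inE => /andP[pU /eqP/val_inj px]; exists p.2.
  by rewrite inE -px -surjective_pairing.
by rewrite -px -surjective_pairing.
Qed.

Lemma col_size_le U (x : 'I_m.+1) : col_size U x <= m - x.
Proof.
rewrite -card_column -(@card_ord_interval m x m) //.
apply/subset_leq_card/subsetP=> y.
rewrite !inE => /union_grid_sub; rewrite inE /= => /andP[_ ->].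
by rewrite -ltnS ltn_ord.
Qed.

(** The grid is closed under passing to smaller points of the triangle, so that
    its columns are initial segments. *)
Lemma union_gridE U p : (p \in union_grid U) =
  (1 <= p.1 < p.2) && (p.2 <= p.1 + col_size U p.1).
Proof.
case: p => x y /=; have ym := ltn_ord y.
apply/idP/andP => [yU|[/andP[x1 xy] yc]].
  have := union_grid_sub yU; rewrite inE /= => /andP[x1 xy].
  split; first by rewrite x1.
  rewrite -leq_subLR -(@card_ord_interval m) // -card_column.
  apply/subset_leq_card/subsetP=> z; rewrite !inE => /andP[xz zy].
  by apply: union_grid_down yU _ _ _; rewrite ?inE //= x1.
apply: contraLR yc => yU; rewrite -ltnNge -card_column.
have sub : column U x \subset [set z : 'I_m.+1 | x < z <= y.-1].
  apply/subsetP=> z; rewrite !inE => zU.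
  have := union_grid_sub zU; rewrite inE /= => /andP[_ xz]; rewrite xz /=.
  rewrite -ltnS prednK; last by lia.
  rewrite ltnNge; apply: contra yU => yz.
  by apply: union_grid_down zU _ _ _; rewrite ?inE //= x1.
have := subset_leq_card sub; rewrite card_ord_interval; lia.
Qed.

Lemma col_size_decr U i : 0 < i -> 0 < col_size U i.+1 ->
  col_size U i.+1 < col_size U i.
Proof.
move=> i0 c0; have im : i.+1 < m.+1.
  case/card_gt0P: c0 => p; rewrite inE => /andP[_ /eqP <-]; exact: ltn_ord.
pose x : 'I_m.+1 := Ordinal im; have cx := @col_size_le U x.
have ym : i.+1 + col_size U i.+1 < m.+1 by move: cx => /=; lia.
have : (x, Ordinal ym) \in union_grid U by rewrite union_gridE /=; lia.
move/union_grid_down=> /(_ (Ordinal (ltnW im), Ordinal ym)).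
rewrite union_gridE inE /= i0 leqnSn => down.
by have := down _ isT (leqnn _); lia.
Qed.

Lemma sum_segment n a c (f : nat -> nat) : a + c <= n ->
  \sum_(y < n | a <= y < a + c) f y = \sum_(k < c) f (a + k).
Proof.
move=> acn; transitivity (\sum_(a <= y < a + c) f y).
  rewrite (@big_nat_widen _ _ _ a (a + c) n) // (@big_nat_widenl _ _ _ a 0) //.
  by rewrite big_mkord; apply: eq_bigl => y; rewrite andbC.
rewrite -{1}[a]add0n big_addn addKn big_mkord.
by apply: eq_bigr => k _; rewrite addnC.
Qed.

(** Column x = i + 1 consists of the points (i + 1, i + 2 + k) with k below its
    size. *)
Lemma sum_union_grid U (f : nat -> nat -> nat) :
  \sum_(p in union_grid U) f p.1 p.2 =
  \sum_(i < m) \sum_(k < col_size U i.+1) f i.+1 (i.+2 + k).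
Proof.
rewrite (eq_bigl
  (fun p => xpredT p.1 && ((p.1, p.2) \in union_grid U))); last first.
  by move=> p; rewrite -surjective_pairing.
rewrite -(pair_big_dep xpredT (fun x y => (x, y) \in union_grid U)
  (fun x y : 'I_m.+1 => f x y)) /=.
rewrite big_ord_recl big1 ?add0n; last by move=> y; rewrite union_gridE.
apply: eq_bigr => i _.
have cle : col_size U i.+1 <= m - i.+1 := @col_size_le U (lift ord0 i).
rewrite -(@sum_segment m.+1 i.+2 (col_size U i.+1) (f i.+1)); last first.
  by have := ltn_ord i; lia.
by apply: eq_bigl => y; rewrite union_gridE /= /bump /= !add1n; lia.
Qed.

Lemma card_union_grid U : #|union_grid U| = \sum_(i < m) col_size U i.+1.
Proof.
rewrite -sum1_card (sum_union_grid U (fun _ _ => 1)).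
by apply: eq_bigr => i _; rewrite sum1_card card_ord.
Qed.

(** The value of g_U at q. *)
Definition points q U : nat := \sum_(p in union_grid U) q ^ (p.1 + p.2 - 3).

Lemma points_columns q U :
  points q U = \sum_(i < m) q ^ (2 * i) * geo q (col_size U i.+1).
Proof.
rewrite /points (sum_union_grid U (fun x y => q ^ (x + y - 3))).
apply: eq_bigr => i _; rewrite /geo big_distrr /=.
by apply: eq_bigr => k _; rewrite -expnD; congr (_ ^ _); lia.
Qed.

(** With the empty columns, in contrast to Mseq. *)
Definition columns U := [seq col_size U i | i <- iota 1 m].

(** Strictly decreasing until 0, and constant from there on. *)
Definition staircase_rel : rel nat := fun a b => (b < a) || (b == 0).

Lemma columns_sorted U : sorted staircase_rel (columns U).
Proof.
apply/(sortedP 0) => i; rewrite size_map size_iota => im.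
rewrite !(nth_map 0) ?size_iota ?nth_iota //; try lia.
rewrite !add1n /staircase_rel; case: posnP => [|c0]; first by rewrite orbT.
by rewrite col_size_decr.
Qed.

Lemma path_staircase0 s : path staircase_rel 0 s -> s = nseq (size s) 0.
Proof. by elim: s => //= a s IH /andP[/eqP -> /IH {1}->]. Qed.

Lemma filter_staircase s : sorted staircase_rel s ->
  [/\ sorted gtn [seq c <- s | 0 < c], sumn [seq c <- s | 0 < c] = sumn s
   & forall q, weight q [seq c <- s | 0 < c] = weight q s].
Proof.
elim: s => //= a s IH ps; have [sF sumF wF] := IH (path_sorted ps).
have [a0|a0] := posnP a.
  move: ps; rewrite a0 => /path_staircase0 ->; rewrite filter_nseq /= sumn_nseq.
  split=> // q; rewrite geo0; elim: (size s) => [|n]; first by rewrite /= muln0.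
  by rewrite /= geo0 !add0n => <-; rewrite muln0.
split=> /=; rewrite ?sumF //; last by move=> q; rewrite wF.
rewrite path_sortedE; last by move=> x y z /= yx zy; exact: ltn_trans zy yx.
rewrite sF andbT; apply/allP=> b; rewrite mem_filter => /andP[b0 bs].
have tr : transitive staircase_rel by move=> x y z; rewrite /staircase_rel; lia.
have /allP/(_ _ bs) := order_path_min tr ps.
by rewrite /staircase_rel (gtn_eqF b0) orbF.
Qed.

Lemma weightE q s :
  weight q s = \sum_(i < size s) q ^ (2 * i) * geo q (nth 0 s i).
Proof.
elim: s => [|a s IH] /=; first by rewrite big_ord0.
rewrite big_ord_recl muln0 mul1n IH big_distrr /=; congr (_ + _).
by apply: eq_bigr => i _; rewrite /bump /= add1n mulnS expnD mulnA.
Qed.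

Lemma mem_Mseq U k : (k \in Mseq U) = (0 < k < m) && (k \in columns U).
Proof.
rewrite mem_sort; apply/mapP/andP => [[k' k'U ->]|[/andP[k0 km] /mapP[i iI kE]]].
  rewrite mem_enum inE in k'U; case/andP: k'U => k0 /existsP[i /andP[i1 /eqP ci]].
  rewrite /= k0 ltn_ord -ci; split=> //; apply: map_f; rewrite mem_iota i1 add1n.
  exact: ltn_ord.
exists (Ordinal km) => //; rewrite mem_enum inE /= k0; apply/existsP.
move: iI; rewrite mem_iota add1n => /andP[i1 im].
by exists (Ordinal im); rewrite /= i1 kE /=.
Qed.

Lemma Mseq_sorted U : sorted gtn (Mseq U).
Proof.
rewrite gtn_sorted_uniq_geq sort_uniq (map_inj_uniq val_inj) enum_uniq /=.
by apply: sort_sorted => a b; rewrite orbC; apply: leq_total.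
Qed.

Lemma gtn_trans : transitive gtn.
Proof. by move=> y x z /= yx zy; apply: ltn_trans zy yx. Qed.

Lemma Mseq_columns U : Mseq U = [seq c <- columns U | 0 < c].
Proof.
apply: (irr_sorted_eq gtn_trans) => [x|||k]; first exact: ltnn.
- exact: Mseq_sorted.
- by case: (filter_staircase (columns_sorted U)).
rewrite mem_Mseq mem_filter -andbA; case: (posnP k) => //= k0; rewrite andbC.
case: (boolP (k \in columns U)) => //= /mapP[i].
rewrite mem_iota add1n => /andP[i1 im] kE.
by have := @col_size_le U (Ordinal im); rewrite /= -kE; lia.
Qed.

Lemma nth_columns U i : i < m -> nth 0 (columns U) i = col_size U i.+1.
Proof. by move=> im; rewrite (nth_map 0) ?size_iota // nth_iota // add1n. Qed.

Lemma weight_Mseq q U : weight q (Mseq U) = points q U.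
Proof.
rewrite Mseq_columns; case: (filter_staircase (columns_sorted U)) => _ _ ->.
rewrite weightE points_columns size_map size_iota.
by apply: eq_bigr => i _; rewrite nth_columns.
Qed.

Lemma sumn_Mseq U : sumn (Mseq U) = #|union_grid U|.
Proof.
rewrite Mseq_columns; case: (filter_staircase (columns_sorted U)) => _ -> _.
rewrite card_union_grid sumnE big_map -[iota 1 m]/(iota (1 + 0) m) iotaDl big_map.
by rewrite -{1}[m]subn0 -/(index_iota 0 m) big_mkord.
Qed.

Lemma Mseq_strict U : strict_partition m.-1 #|union_grid U| (Mseq U).
Proof.
rewrite /strict_partition sumn_Mseq eqxx andbT.
rewrite path_sortedE; last exact: gtn_trans.
rewrite Mseq_sorted andbT -all_predI; apply/allP=> k.
rewrite mem_Mseq /= => /andP[km _].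
lia.
Qed.

(** In terms of the grid: the ends (x, x + m_x) of the columns lie in weakly
    decreasing rows. *)
Lemma path_gtn_nth n s i j : path gtn n s -> i <= j < size s ->
  nth 0 s j + j <= nth 0 s i + i < n.
Proof.
elim: s n i j => [|a s IH] n i j /=; first by lia.
case/andP=> an ps; case: j => [|j]; first by case: i => /=; lia.
case: i => [|i] ij; last by have := IH a i j ps ij; rewrite /=; lia.
by have := IH a 0 j ps; rewrite /= addn0; lia.
Qed.

(** The union of the cycles indexed by all points of the shape has this shape as
    its grid, because the shape is closed under passing to smaller points. *)
Lemma strict_realized K s : strict_partition m.-1 K s ->
  exists U, [/\ U \subset grid m, #|union_grid U| = K & Mseq U = s].
Proof.
case/and3P=> ps pos /eqP sumE.
have [m0|m0] := posnP m.
  have s0 : s = [::].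
    by case: s ps pos {sumE} => //= a s /andP[am _] /andP[a0 _]; lia.
  exists set0; rewrite sub0set -sumn_Mseq (_ : Mseq _ = [::]) -?sumE ?s0 //.
  by case: (Mseq set0) (@mem_Mseq set0) => // k t /(_ k); rewrite mem_head; lia.
rewrite prednK // in ps.
pose U := [set p in grid m | (p.2 <= p.1 + nth 0 s p.1.-1)%N].
have UE : union_grid U = U.
  apply/setP=> p; apply/idP/idP; last first.
    move=> pU; apply/union_gridP; exists p => //; move: pU.
    by rewrite !inE !leqnn => /andP[->].
  case/union_gridP=> -[a b]; rewrite !inE /= => /andP[/andP[a1 ab] bs].
  case: p => x y /= /and3P[/andP[x1 xy] xa yb]; rewrite x1 xy /=.
  have sz : a.-1 < size s.
    by rewrite ltnNge; apply/negP=> sa; move: bs; rewrite nth_default //; lia.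
  by have := @path_gtn_nth _ _ x.-1 a.-1 ps; lia.
have colE i : i < m -> col_size U i.+1 = nth 0 s i.
  move=> im; rewrite -(@card_column U (Ordinal (im : i.+1 < m.+1))) /=.
  have bound : i.+1 + nth 0 s i <= m.
    have [si|si] := leqP (size s) i; first by rewrite nth_default // addn0.
    by have := @path_gtn_nth _ _ i i ps; lia.
  rewrite (_ : column _ _ = [set y : 'I_m.+1 | i.+1 < y <= i.+1 + nth 0 s i]).
    by rewrite card_ord_interval //; lia.
  by apply/setP=> y; rewrite !inE UE !inE.
have MU : Mseq U = s.
  apply: (irr_sorted_eq gtn_trans) => [x|||k]; first exact: ltnn.
  - exact: Mseq_sorted.
  - exact: path_sorted ps.
  rewrite mem_Mseq; apply/andP/idP => [[/andP[k0 km] /mapP[i]]|ks].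
    rewrite mem_iota add1n => /andP[i1 im] kE.
    have kn : k = nth 0 s i.-1 by rewrite kE -[in LHS](prednK i1) colE //; lia.
    rewrite kn mem_nth // ltnNge; apply/negP=> si.
    by move: k0; rewrite kn nth_default.
  have k0 : 0 < k := allP pos _ ks.
  have := ps; rewrite path_sortedE; last exact: gtn_trans.
  case/andP=> /allP/(_ _ ks) /= km _; rewrite k0 km; split=> //.
  have im : index k s < m.
    have := @path_gtn_nth _ _ (index k s) (index k s) ps.
    by rewrite leqnn index_mem ks; lia.
  apply/mapP; exists (index k s).+1; first by rewrite mem_iota; lia.
  by rewrite colE // nth_index.
exists U; split=> //; first by apply/subsetP=> p; rewrite inE => /andP[].
by rewrite -sumn_Mseq MU.
Qed.

End Columns.

(** * Comparing polynomials by one large value *)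

Lemma last_difference (c c' : nat -> nat) n :
  (forall i, i < n -> c i = c' i) \/
  exists d, [/\ d < n, c d != c' d & forall i, d < i < n -> c i = c' i].
Proof.
elim: n => [|n [eqn|[d [dn cd eqd]]]]; first by left.
  have [eq|neq] := eqVneq (c n) (c' n); last first.
    by right; exists n; split=> // i; lia.
  by left=> i; rewrite ltnS leq_eqVlt => /predU1P[->|/eqn].
have [eq|neq] := eqVneq (c n) (c' n); last first.
  by right; exists n; split=> // i; lia.
right; exists d; split=> // [|i]; first exact: leqW.
by rewrite ltnS [i <= n]leq_eqVlt andb_orr => /orP[/andP[_ /eqP ->]|/eqd].
Qed.

Lemma digits_lt (c : nat -> nat) q n : (forall i, c i < q) ->
  \sum_(i < n) c i * q ^ i < q ^ n.
Proof.
move=> cq; elim: n => [|n IH]; first by rewrite big_ord0.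
rewrite big_ord_recr expnS /=; apply: leq_trans (leq_mul (cq n) (leqnn (q ^ n))).
by rewrite mulSn -addSn leq_add2r.
Qed.

(** Coefficients below q are the digits in base q of the value at q. *)
Lemma lex_digits (c c' : nat -> nat) q n d : (forall i, c i < q) -> d < n ->
  c d < c' d -> (forall i, d < i < n -> c i = c' i) ->
  \sum_(i < n) c i * q ^ i < \sum_(i < n) c' i * q ^ i.
Proof.
move=> cq; elim: n => // n IH; rewrite ltnS leq_eqVlt !big_ord_recr /=.
case/predU1P=> [->|dn] lt eq.
  apply: leq_trans (leq_addl _ _); apply: leq_trans (leq_mul lt (leqnn (q ^ n))).
  by rewrite mulSn -addSn leq_add2r digits_lt.
rewrite eq ?dn ?leqnn // ltn_add2r; apply: IH => // i /andP[di id].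
by apply: eq; rewrite di ltnW.
Qed.

Section Order.
Variable m : nat.
Implicit Types (U V : {set 'I_m.+1 * 'I_m.+1}) (p : 'I_m.+1 * 'I_m.+1).

(** The coefficient of q^d in g_U. *)
Definition antidiagonal U d : nat :=
  #|[set p in union_grid U | (p.1 + p.2 - 3 == d)%N]|.

Lemma coef_gpoly U d : ((gpoly U)`_d = (antidiagonal U d)%:Z)%R.
Proof.
rewrite /gpoly coef_sum /antidiagonal -sum1_card -natz natr_sum.
rewrite [RHS](eq_bigl
  (fun p => (p \in union_grid U) && (p.1 + p.2 - 3 == d))); last first.
  by move=> p; rewrite inE.
rewrite big_mkcondr /=; apply: eq_bigr => p _.
by rewrite coefXn eq_sym; case: eqP.
Qed.

(** All exponents x + y - 3 are smaller than 2m. *)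
Lemma points_antidiagonal q U :
  points q U = \sum_(d < m + m) antidiagonal U d * q ^ d.
Proof.
rewrite /points.
transitivity (\sum_(p in union_grid U)
  \sum_(d < m + m | p.1 + p.2 - 3 == d) q ^ d).
  apply: eq_bigr => -[x y] /union_grid_sub; rewrite inE /= => /andP[x1 xy].
  have pm : x + y - 3 < m + m by have := ltn_ord x; have := ltn_ord y; lia.
  rewrite (big_pred1 (Ordinal pm)) //.
rewrite (exchange_big_dep xpredT) //=; apply: eq_bigr => d _.
rewrite sum_nat_const; congr (_ * _); apply: eq_card => p.
by rewrite !inE.
Qed.

Definition grid_bound : nat := #|{: 'I_m.+1 * 'I_m.+1}|.

Lemma antidiagonal_le U d : antidiagonal U d <= grid_bound.
Proof. exact: max_card. Qed.

Lemma antidiagonal_big U d : m + m <= d -> antidiagonal U d = 0.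
Proof.
move=> md; apply/eqP; rewrite cards_eq0; apply/eqP/setP=> -[x y]; rewrite !inE /=.
apply/negP=> /andP[/union_grid_sub]; rewrite inE /=.
by have := ltn_ord x; have := ltn_ord y; lia.
Qed.

(** As coefficients are nonnegative, a larger degree is just a larger coefficient
    in the last position where the coefficients differ. *)
Lemma gt_g_last_difference U V : gt_g V U <->
  exists2 d, antidiagonal U d < antidiagonal V d &
    forall i, d < i -> antidiagonal U i = antidiagonal V i.
Proof.
have coef_size (W : {set 'I_m.+1 * 'I_m.+1}) j :
    (size (gpoly W) <= j)%N -> antidiagonal W j = 0.
  by move=> /(nth_default 0%R); rewrite coef_gpoly => -[].
split=> [[lt|[_ [d [lt eq]]]]|[d lt eq]].
- case sV : (size (gpoly V)) lt => [//|d]; rewrite ltnS => Ud.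
  exists d; last by move=> i di; rewrite !coef_size ?sV // (leq_trans Ud) // ltnW.
  rewrite (coef_size U) // lt0n; apply/eqP=> V0.
  have : lead_coef (gpoly V) != 0%R by rewrite lead_coef_eq0 -size_poly_eq0 sV.
  by rewrite lead_coefE sV coef_gpoly V0.
- exists d; first by move: lt; rewrite !coef_gpoly ltz_nat.
  by move=> i /eq; rewrite !coef_gpoly => -[].
have [|sV] := ltnP (size (gpoly U)) (size (gpoly V)); first by left.
right; split; last first.
  exists d; split; first by rewrite !coef_gpoly ltz_nat.
  by move=> i di; rewrite !coef_gpoly eq.
apply/eqP; rewrite eqn_leq sV /=; apply/leq_sizeP=> j Vj.
rewrite coef_gpoly; have [jd|dj|jd] := ltngtP j d.
- by move: lt; rewrite (coef_size V d) // (leq_trans Vj) // ltnW.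
- by rewrite eq // coef_size.
- by move: lt; rewrite (coef_size V d) // -jd.
Qed.

(** No coefficient exceeds the number of pairs, so that a larger q has the
    coefficients as digits. *)
Lemma gt_gP q U V : grid_bound < q -> gt_g V U <-> points q U < points q V.
Proof.
move=> Bq; have digit W i : antidiagonal W i < q.
  exact: leq_ltn_trans (antidiagonal_le W i) Bq.
have range A B d : antidiagonal A d < antidiagonal B d -> d < m + m.
  move=> lt; rewrite ltnNge; apply/negP=> /antidiagonal_big Bd.
  by rewrite (Bd B) in lt.
rewrite gt_g_last_difference !points_antidiagonal; split.
  case=> d lt eq.
  apply: (lex_digits (digit U) (range _ _ _ lt) lt) => i /andP[di _].
  exact: eq.
have [eq|[d [dm neq eq]]] :=
  last_difference (antidiagonal U) (antidiagonal V) (m + m).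
  rewrite (eq_bigr (fun d : 'I__ => antidiagonal V d * q ^ d)) ?ltnn //.
  by move=> d _; rewrite eq.
have eq' i : d < i -> antidiagonal U i = antidiagonal V i.
  move=> di; have [im|mi] := ltnP i (m + m); first by apply: eq; rewrite di.
  by rewrite !antidiagonal_big.
move=> ltUV; exists d => //.
have [//|VU|E] := ltngtP; last by rewrite E eqxx in neq.
have := lex_digits (digit V) dm VU (fun i h => esym (eq i h)).
by rewrite ltnNge ltnW.
Qed.

End Order.

(** * The spanning dimension *)

Local Open Scope ring_scope.

Lemma minor_relation (F : fieldType) (a b c d x y : F) :
  x * a + y * b = 0 -> x * c + y * d = 0 -> a * d - c * b != 0 ->
  x = 0 /\ y = 0.
Proof.
move=> row1 row2 minor; split; apply: (mulIf minor); rewrite mul0r.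
  have -> : x * (a * d - c * b) =
    (x * a + y * b) * d - (x * c + y * d) * b by ring.
  by rewrite row1 row2 !mul0r subrr.
have -> : y * (a * d - c * b) =
  (x * c + y * d) * a - (x * a + y * b) * c by ring.
by rewrite row1 row2 !mul0r subrr.
Qed.

Section TwoVectors.
Variables (F : fieldType) (V : vectType F).
Implicit Types (u v w : V) (W : {vspace V}).

Lemma free2P u v :
  (forall a b : F, a *: u + b *: v = 0 -> a = 0 /\ b = 0) -> free [:: u; v].
Proof.
move=> indep; rewrite free_cons span_seq1 seq1_free; apply/andP; split.
  apply/negP=> /vlineP[k uE]; have [] := indep 1 (- k).
    by rewrite uE scale1r scaleNr subrr.
  by move/eqP; rewrite oner_eq0.
apply/eqP=> v0; have [] := indep 0 1; first by rewrite v0 scale0r scaler0 addr0.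
by move=> _ /eqP; rewrite oner_eq0.
Qed.

Lemma span2P u v w :
  w \in <<[:: u; v]>>%VS -> exists a b : F, w = a *: u + b *: v.
Proof.
rewrite span_cons span_seq1 => /memv_addP[_ /vlineP[a ->] [_ /vlineP[b ->] ->]].
by exists a, b.
Qed.

Lemma mem_span2l u v : u \in <<[:: u; v]>>%VS.
Proof. by rewrite memv_span ?mem_head. Qed.

Lemma mem_span2r u v : v \in <<[:: u; v]>>%VS.
Proof. by rewrite memv_span // !inE eqxx orbT. Qed.

Lemma span2_sub u v W : (<<[:: u; v]>> <= W)%VS = (u \in W) && (v \in W).
Proof.
apply/span_subvP/andP => [sub|[uW vW] x].
  by split; apply: sub; rewrite !inE eqxx ?orbT.
by rewrite !inE => /orP[] /eqP ->.
Qed.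

Lemma span2_eq u v W :
  \dim W = 2%N -> free [:: u; v] -> u \in W -> v \in W -> <<[:: u; v]>>%VS = W.
Proof.
move=> dW /eqP dX uW vW; apply/eqP; rewrite eqEdim span2_sub uW vW /=.
by rewrite dW dX.
Qed.

End TwoVectors.

Section Coordinates.
Variables (F : fieldType) (V : vectType F) (m : nat) (e : m.-tuple V).
Hypothesis he : basis_of fullv e.
Implicit Types (u v w : V) (W : {vspace V}) (p ab : 'I_m.+1 * 'I_m.+1).
Implicit Types (U : {set 'I_m.+1 * 'I_m.+1}).

Let fe : free e := basis_free he.

Lemma coord_vec k (ltkm : (k < m)%N) (i : 'I_m) :
  coord e i e`_k = (k == i :> nat)%:R.
Proof. by rewrite (coord_free (Ordinal ltkm) i fe) -val_eqE. Qed.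

Lemma coord_inj u v : (forall i, coord e i u = coord e i v) -> u = v.
Proof.
move=> eq; rewrite (coord_basis he (memvf u)) (coord_basis he (memvf v)).
by apply: eq_bigr => i _; rewrite eq.
Qed.

Lemma coord_gen (f : 'I_m -> F) i : coord e i (\sum_j f j *: e`_j) = f i.
Proof. exact: coord_sum_free. Qed.

(** The flag is cut out by the vanishing of the last coordinates. *)
Lemma flagP a v :
  reflect (forall i : 'I_m, (a <= i)%N -> coord e i v = 0) (v \in flag e a).
Proof.
apply: (iffP idP) => [va i ai|v0].
  have sub : (flag e a <= lker (linfun (coord e i : V -> F^o)))%VS.
    apply/span_subvP=> x /(nthP 0)[j]; rewrite size_take size_tuple => ja <-.
    have {ja} [ja jm] : (j < a)%N /\ (j < m)%N by move: ja; case: ifP; lia.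
    rewrite memv_ker lfunE /= nth_take // (coord_vec jm).
    by rewrite (_ : (j == i :> nat) = false) //; lia.
  by have /(subvP sub) := va; rewrite memv_ker lfunE /= => /eqP.
rewrite (coord_basis he (memvf v)) memv_suml // => i _.
have [ai|ia] := leqP a i; first by rewrite v0 // scale0r mem0v.
apply/memvZ/memv_span/(nthP 0); exists (val i); last by rewrite nth_take.
by rewrite size_take size_tuple; case: ifP => // _; apply: ltn_ord.
Qed.

Lemma span2_cycle (a b : 'I_m.+1) u v : free [:: u; v] -> u \in flag e a ->
  u \in flag e b -> v \in flag e b -> schubert_cycle e (a, b) <<[:: u; v]>>.
Proof.
move=> fuv ua ub vb; apply/and3P; split.
- by move: fuv; rewrite /free /= => /eqP ->.
- rewrite lt0n dimv_eq0; apply/eqP=> cap0.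
  have : u \in (<<[:: u; v]>> :&: flag e a)%VS by rewrite memv_cap mem_span2l.
  rewrite cap0 memv0 => /eqP u0.
  by move: fuv; rewrite u0 => /free_not0 /(_ (mem_head _ _)); rewrite eqxx.
by rewrite span2_sub ub vb.
Qed.

Lemma cap_flag_neq0 a W : (1 <= \dim (W :&: flag e a))%N ->
  exists w, [/\ w != 0, w \in W & w \in flag e a].
Proof.
rewrite lt0n dimv_eq0 -vpick0 => w0; exists (vpick (W :&: flag e a)).
by have := memv_pick (W :&: flag e a); rewrite memv_cap => /andP[].
Qed.

Lemma wedge_alt u v i j : wedge e u v j i = - wedge e u v i j.
Proof. by rewrite !mxE; ring. Qed.

Lemma wedge_diag u v i : wedge e u v i i = 0.
Proof. by rewrite !mxE subrr. Qed.

(** The coordinates of W beyond the second flag space vanish. If both coordinates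
    lie beyond the first one, then W has a nonzero vector on which both of them
    vanish; if the minor were nonzero, then u and v would span W, and this vector
    would be a nontrivial relation between the two rows of the minor. *)
Lemma wedge_outside ab W u v (i j : 'I_m) :
  schubert_cycle e ab W -> u \in W -> v \in W -> (i < j)%N ->
  ~~ ((i < ab.1) && (j < ab.2))%N -> wedge e u v i j = 0.
Proof.
case: ab => a b /= /and3P[/eqP dW capW Wb] uW vW ij out; rewrite mxE.
have [bj|jb] := leqP b j.
  have coord0 x : x \in W -> coord e j x = 0.
    by move=> xW; apply: (flagP b x) (subvP Wb _ xW) _ bj.
  by rewrite !coord0 // mulr0 mul0r subrr.
have ai : (a <= i)%N by move: out; rewrite jb andbT -leqNgt.
have [w [w0 wW /flagP wa]] := cap_flag_neq0 capW.
apply/eqP; apply: contraNT w0 => minor.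
have fuv : free [:: u; v].
  apply: free2P => x y xy0; apply: minor_relation minor;
    by rewrite -!linearZ -linearD xy0 linear0.
have := wW; rewrite -(span2_eq dW fuv uW vW) => /span2P[x [y wE]].
have row (k : 'I_m) : (a <= k)%N -> x * coord e k u + y * coord e k v = 0.
  by move=> ak; rewrite -(wa k ak) wE linearD !linearZ.
have [x0 y0] := minor_relation (row i ai) (row j (leq_trans ai (ltnW ij))) minor.
by rewrite wE x0 y0 !scale0r addr0.
Qed.

(** e_x /\ e_y for the 1-based pair p = (x, y). *)
Definition unit_wedge p : 'M[F]_m := wedge e e`_(p.1.-1) e`_(p.2.-1).

Lemma unit_wedgeE p i j : p \in grid m -> unit_wedge p i j =
  (p.1.-1 == i :> nat)%:R * (p.2.-1 == j :> nat)%:R -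
  (p.1.-1 == j :> nat)%:R * (p.2.-1 == i :> nat)%:R.
Proof.
case: p => x y; rewrite inE mxE /= => /andP[x1 xy].
by have := ltn_ord y => ym; rewrite !coord_vec //; lia.
Qed.

(** The 1-based pair of the 0-based matrix position (i, j). *)
Definition grid_pair (i j : 'I_m) : 'I_m.+1 * 'I_m.+1 :=
  (inord i.+1, inord j.+1).

Lemma grid_pairE i j p :
  p \in grid m ->
  (p == grid_pair i j) = (p.1.-1 == i :> nat) && (p.2.-1 == j :> nat).
Proof.
case: p => x y; rewrite inE /= => /andP[x1 xy].
rewrite xpair_eqE -!val_eqE /= !inordK ?ltnS ?ltn_ord //; lia.
Qed.

Lemma unit_wedge_lt p (i j : 'I_m) : p \in grid m -> (i < j)%N ->
  unit_wedge p i j = (p == grid_pair i j)%:R.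
Proof.
move=> pG ij; rewrite unit_wedgeE // grid_pairE // -natrM mulnb.
suff -> : (p.1.-1 == j :> nat)%:R * (p.2.-1 == i :> nat)%:R = 0 :> F.
  by rewrite subr0.
move: pG; case: p => x y; rewrite inE /= => /andP[x1 xy].
rewrite -natrM mulnb (_ : _ && _ = false) //; lia.
Qed.

Definition cone_span U : {vspace 'M[F]_m} :=
  <<[seq unit_wedge p | p <- enum (union_grid U)]>>%VS.

(** In the position of a point of the grid, the wedge of this point is the only
    one with a nonzero entry. *)
Lemma unit_wedge_free U :
  free [seq unit_wedge p | p <- enum (union_grid U)].
Proof.
set s := enum _; apply/(@freeP _ _ _ (map_tuple unit_wedge (in_tuple s))).
move=> k k0 i; have p0 : 'I_m.+1 * 'I_m.+1 := (ord0, ord0).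
have sG j : (j < size s)%N -> nth p0 s j \in grid m.
  by move=> js; apply: (@union_grid_sub _ U); rewrite -mem_enum mem_nth.
have := sG i (ltn_ord i); rewrite inE => /andP[x1 xy].
set x := (nth p0 s i).1 in x1 xy; set y := (nth p0 s i).2 in xy.
have ym := ltn_ord y.
have [xm ym'] : (x.-1 < m)%N /\ (y.-1 < m)%N by lia.
have /matrixP/(_ (Ordinal xm) (Ordinal ym')) := k0.
rewrite summxE mxE (bigD1 i) //= mxE (nth_map p0) ?ltn_ord //.
rewrite unit_wedgeE ?sG ?ltn_ord //= !eqxx mulr1 -/x -/y.
rewrite (_ : (x.-1 == y.-1) = false) ?mul0r ?subr0 ?mulr1; last by lia.
rewrite big1 ?addr0 // => j ji.
rewrite mxE (nth_map p0) ?ltn_ord // unit_wedgeE ?sG ?ltn_ord //=.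
have := sG j (ltn_ord j); rewrite inE => /andP[].
case E : (nth p0 s j) => [x' y'] /= x1' xy'.
have diff : ~~ ((x' == x) && (y' == y)).
  apply: contra ji => /andP[/eqP xE /eqP yE].
  rewrite -val_eqE /= -(nth_uniq p0 (ltn_ord j) (ltn_ord i) (enum_uniq _)).
  by rewrite E xE yE /x /y -surjective_pairing.
rewrite -!val_eqE /= in diff.
case: eqP => [xE|]; case: eqP => [yE|] //; rewrite ?mulr0 ?mul0r ?sub0r ?mulr1.
all: try (case: eqP => [xE'|]; case: eqP => [yE'|] //).
all: rewrite ?mulr0 ?mul0r ?mul1r ?oppr0 ?mulr0 //; lia.
Qed.

Lemma dim_cone_span U : \dim (cone_span U) = #|union_grid U|.
Proof. by rewrite (eqP (unit_wedge_free U)) size_map cardE. Qed.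

(** An element of the cone is an alternating matrix that vanishes outside the
    grid by wedge_outside. Conversely the coordinate plane of e_x and e_y belongs
    to the union for each point (x, y) of the grid. *)
Lemma cone_spanP U : is_linear_span (affine_cone e U) (cone_span U).
Proof.
split=> [w [W /exists_inP[ab abU Wab] [u [v [uW vW ->]]]]|L coneL].
  set w0 := wedge e u v.
  (* The entry of w0 at the 0-based position of p. *)
  pose c p := if insub p.1.-1 is Some i then
    if insub p.2.-1 is Some j then w0 i j else 0 else 0.
  have -> : w0 = \sum_(p in union_grid U) c p *: unit_wedge p.
    have upper (i j : 'I_m) : (i < j)%N ->
        w0 i j = (\sum_(p in union_grid U) c p *: unit_wedge p) i j.
      move=> ij; rewrite summxE; set p0 := grid_pair i j.
      have entry p : p \in union_grid U ->
          (c p *: unit_wedge p) i j = c p * (p == p0)%:R.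
        by move/union_grid_sub=> pG; rewrite mxE unit_wedge_lt.
      have p0E : (p0.1 = i.+1 :> nat) * (p0.2 = j.+1 :> nat).
        by rewrite /= !inordK ?ltnS.
      have [p0U|p0U] := boolP (p0 \in union_grid U).
        rewrite (bigD1 p0) //= entry // eqxx mulr1 big1 ?addr0.
          by rewrite /c !p0E !valK.
        by move=> p /andP[pU /negbTE pp0]; rewrite entry // pp0 mulr0.
      rewrite big1 => [|p pU]; last first.
        rewrite entry // (_ : (p == p0) = false) ?mulr0 //.
        by apply: contraNF p0U => /eqP <-.
      apply: (wedge_outside Wab) => //; apply: contra p0U => /andP[ia jb].
      by apply/union_gridP; exists ab => //; rewrite !inE !p0E /= ltnS ij ia jb.
    apply/matrixP=> i j; have [ij|ji|ij] := ltngtP i j; first exact: upper.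
      rewrite /w0 wedge_alt -/w0 upper // !summxE -sumrN.
      by apply: eq_bigr => p _; rewrite !mxE /=; ring.
    rewrite (val_inj ij) /w0 wedge_diag summxE big1 // => p _.
    by rewrite mxE /unit_wedge wedge_diag mulr0.
  apply: memv_suml => p pU; apply/memvZ/memv_span/map_f.
  by rewrite mem_enum.
apply/span_subvP=> _ /mapP[p pU ->]; rewrite mem_enum in pU.
have /union_gridP[[a b] abU] := pU; rewrite inE => /and3P[].
case: p {pU} => x y; rewrite inE /= => /andP[x1 xy] xa yb.
have ym := ltn_ord y.
have [xm ym'] : (x.-1 < m)%N /\ (y.-1 < m)%N by lia.
apply: coneL; exists <<[:: e`_(x.-1); e`_(y.-1)]>>%VS; last first.
  by exists e`_(x.-1), e`_(y.-1); rewrite mem_span2l mem_span2r.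
apply/exists_inP; exists (a, b) => //; apply: span2_cycle.
- apply: free2P => k l kl0.
  have := congr1 (coord e (Ordinal xm)) kl0.
  have := congr1 (coord e (Ordinal ym')) kl0.
  rewrite !linearD !linearZ !linear0 /= !coord_vec // !eqxx.
  have yx : (y.-1 == x.-1) = false by lia.
  rewrite [x.-1 == y.-1]eq_sym !yx.
  by rewrite !mulr0 !mulr1 addr0 add0r.
- by apply/flagP=> i ai; rewrite coord_vec // (_ : (_ == _) = false) //; lia.
- by apply/flagP=> i ai; rewrite coord_vec // (_ : (_ == _) = false) //; lia.
- by apply/flagP=> i ai; rewrite coord_vec // (_ : (_ == _) = false) //; lia.
Qed.

Lemma has_spanning_dimE U K : has_spanning_dim e U K <-> #|union_grid U| = K.
Proof.
split=> [[L [coneL minL] <-]|<-].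
  have [coneS minS] := cone_spanP U.
  rewrite -dim_cone_span; congr (\dim _); apply/eqP.
  by rewrite eqEsubv minS ?minL.
by exists (cone_span U); [apply: cone_spanP | apply: dim_cone_span].
Qed.

End Coordinates.

(** * Counting points by echelon forms *)
Section Count.
Variables (F : finFieldType) (V : vectType F) (m : nat) (e : m.-tuple V).
Hypothesis he : basis_of fullv e.
Implicit Types (u v w : V) (W : {vspace V}) (p ab : 'I_m.+1 * 'I_m.+1).
Implicit Types (U : {set 'I_m.+1 * 'I_m.+1}).
Local Notation row := {ffun 'I_m -> F}.

(** The coordinates in P are free, the other ones are prescribed by c. *)
Definition affine_rows (P : pred 'I_m) (c : 'I_m -> F) : {set row} :=
  [set f : row | [forall i, P i || (f i == c i)]].

Lemma affine_rowsP P c (f : row) :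
  reflect (forall i, ~~ P i -> f i = c i) (f \in affine_rows P c).
Proof.
rewrite inE; apply: (iffP forallP) => fP i.
  by move=> Pi; apply/eqP; have := fP i; rewrite (negbTE Pi).
by case: (boolP (P i)) => //= Pi; rewrite fP.
Qed.

Lemma card_affine_rows P c : #|affine_rows P c| = (#|F| ^ #|P|)%N.
Proof.
transitivity #|family (fun i => if P i then predT else pred1 (c i))|.
  apply: eq_card => f; apply/affine_rowsP/familyP => fP i.
    by case: ifP => // /negbT/fP; rewrite inE => ->.
  by move=> /negbTE Pi; have := fP i; rewrite Pi inE => /eqP.
rewrite card_family foldrE big_map big_enum /=.
rewrite (bigID P) /= [X in (_ * X)%N]big1 ?muln1.
  under eq_bigr => i Pi do rewrite Pi.
  by rewrite prod_nat_const.
by move=> i /negbTE ->; rewrite card1.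
Qed.

(** Pairs of rows in reduced echelon form with pivot columns p.1 < p.2: the first
    row ends with a 1 in column p.1, the second one with a 1 in column p.2, and
    the second row vanishes in column p.1. Row 1 has p.1 - 1 free entries and row
    2 has p.2 - 2, which gives the exponent of card_echelon. *)
Definition free_cols1 p : pred 'I_m := fun i => (i.+1 < p.1)%N.
Definition free_cols2 p : pred 'I_m :=
  fun i => ((i.+1 < p.2) && (i.+1 != p.1))%N.

Definition echelon p : {set row * row} :=
  setX (affine_rows (free_cols1 p) (fun i => (i.+1 == p.1)%:R))
       (affine_rows (free_cols2 p) (fun i => (i.+1 == p.2)%:R)).

Lemma card_echelon p :
  p \in grid m -> #|echelon p| = (#|F| ^ (p.1 + p.2 - 3))%N.
Proof.
case: p => x y; rewrite inE /= => /andP[x1 xy]; have ym := ltn_ord y.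
rewrite cardsX !card_affine_rows -expnD; congr (_ ^ _)%N.
have -> : #|free_cols1 (x, y)| = x.-1.
  rewrite -[RHS](@card_ord_ltn m); last by lia.
  by apply: eq_card => i; rewrite !inE /free_cols1 /in_mem /=; lia.
have xm : (x.-1 < m)%N by lia.
have ylt : (y.-1 <= m)%N by lia.
have := card_ord_ltn ylt; rewrite (cardD1 (Ordinal xm)) inE /=.
have -> : (x.-1 < y.-1)%N by lia.
have -> : #|free_cols2 (x, y)| =
    #|[predD1 [pred i : 'I_m | (i < y.-1)%N] & Ordinal xm]|.
  apply: eq_card => i; rewrite !inE /free_cols2 /in_mem /= -val_eqE /=; lia.
rewrite add1n; set n := #|_|; rewrite -/n; lia.
Qed.

Definition vec (f : row) : V := \sum_i f i *: e`_i.

Lemma coord_row (f : row) i : coord e i (vec f) = f i.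
Proof. exact: coord_gen. Qed.

Definition row_of v : row := [ffun i => coord e i v].

Lemma vec_row_of v : vec (row_of v) = v.
Proof. by apply: (coord_inj he) => i; rewrite coord_row ffunE. Qed.

Lemma echelonP p (f g : row) : reflect
  [/\ forall i : 'I_m, i.+1 = p.1 -> f i = 1,
      forall i : 'I_m, (p.1 < i.+1)%N -> f i = 0,
      forall i : 'I_m, i.+1 = p.2 -> g i = 1,
      forall i : 'I_m, (p.2 < i.+1)%N -> g i = 0 &
      forall i : 'I_m, i.+1 = p.1 -> p.1 != p.2 :> nat -> g i = 0]
  ((f, g) \in echelon p).
Proof.
apply: (iffP setXP) => [[/affine_rowsP fP /affine_rowsP gP]|[f1 f0 g1 g0 gx]].
  split=> i.
  - by move=> ix; rewrite fP /free_cols1 ix ?eqxx ?ltnn.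
  - by move=> ix; rewrite fP /free_cols1 ?(gtn_eqF ix) // -leqNgt ltnW.
  - by move=> iy; rewrite gP /free_cols2 iy ?eqxx ?ltnn.
  - by move=> iy; rewrite gP /free_cols2 ?(gtn_eqF iy) // negb_and -leqNgt ltnW.
  - by move=> ix /negbTE xy; rewrite gP /free_cols2 ix ?eqxx ?andbF // xy.
split; apply/affine_rowsP=> i; rewrite /free_cols1 /free_cols2.
  by rewrite -leqNgt leq_eqVlt => /predU1P[/esym ix|ix];
    [rewrite f1 ?ix ?eqxx | rewrite f0 // gtn_eqF].
rewrite negb_and negbK -leqNgt leq_eqVlt.
have [iy _|iy] := eqVneq i.+1 p.2; first by rewrite g1.
case/orP=> [|/eqP ix]; last by rewrite gx // -ix.
exact: g0.
Qed.

Definition row_span (z : row * row) : {vspace V} :=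
  <<[:: vec z.1; vec z.2]>>%VS.

Lemma echelon_free p (f g : row) : p \in grid m -> (f, g) \in echelon p ->
  free [:: vec f; vec g].
Proof.
case: p => x y; rewrite inE /= => /andP[x1 xy] /echelonP[/= f1 f0 g1 g0 gx].
have ym := ltn_ord y.
have [xm ym'] : (x.-1 < m)%N /\ (y.-1 < m)%N by lia.
apply: free2P => a b ab0.
have coords i : a * f i + b * g i = 0.
  by rewrite -(coord_row f) -(coord_row g) -!linearZ -linearD ab0 linear0.
have := coords (Ordinal xm); have := coords (Ordinal ym').
have -> : f (Ordinal xm) = 1 by apply: f1 => /=; lia.
have -> : f (Ordinal ym') = 0 by apply: f0 => /=; lia.
have -> : g (Ordinal xm) = 0 by apply: gx => /=; lia.
have -> : g (Ordinal ym') = 1 by apply: g1 => /=; lia.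
by rewrite !mulr0 !mulr1 add0r addr0.
Qed.

(** This makes echelon forms unique, when it is applied in both directions to two
    forms of the same plane: first the second pivots agree, then the first
    pivots, and then the rows themselves. *)
Lemma echelon_sub p p' (f g f' g' : row) :
  p \in grid m -> p' \in grid m ->
  (f, g) \in echelon p -> (f', g') \in echelon p' ->
  (row_span (f', g') <= row_span (f, g))%VS ->
  (p'.2 <= p.2)%N /\
  (p.2 = p'.2 -> (p'.1 <= p.1)%N /\ (p.1 = p'.1 -> f' = f /\ g' = g)).
Proof.
case: p => x y; case: p' => x' y'; rewrite inE => /andP[/= x1 xy].
rewrite inE => /andP[/= x1' xy'].
move=> /echelonP[/= f1 f0 g1 g0 gx] /echelonP[/= f1' f0' g1' g0' gx'].
rewrite span2_sub => /andP[/span2P[a [b fE]] /span2P[c [d gE]]].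
have {}fE i : f' i = a * f i + b * g i.
  by rewrite -(coord_row f') fE linearD !linearZ /= !coord_row.
have {}gE i : g' i = c * f i + d * g i.
  by rewrite -(coord_row g') gE linearD !linearZ /= !coord_row.
have ym := ltn_ord y; have ym' := ltn_ord y'.
have [xi yi] : (x.-1 < m)%N /\ (y.-1 < m)%N by lia.
have [xi' yi'] : (x'.-1 < m)%N /\ (y'.-1 < m)%N by lia.
have one0 : (1 : F) = 0 -> False by move/eqP; rewrite oner_eq0.
split.
  rewrite leqNgt; apply/negP=> yy; apply: one0.
  rewrite -(g1' (Ordinal yi')) /=; last by lia.
  by rewrite gE f0 ?g0 /= ?mulr0 ?addr0 //; lia.
move=> yE; have yE' : y = y' :> nat by rewrite yE.
have b0 : b = 0.
  have := fE (Ordinal yi); rewrite f0' /=; last by lia.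
  by rewrite f0 ?g1 /= ?mulr0 ?mulr1 ?add0r //; lia.
split.
  rewrite leqNgt; apply/negP=> xx; apply: one0.
  rewrite -(f1' (Ordinal xi')) /=; last by lia.
  by rewrite fE b0 f0 /= ?mulr0 ?mul0r ?addr0 //; lia.
move=> xE; have xE' : x = x' :> nat by rewrite xE.
have a1 : a = 1.
  have := fE (Ordinal xi); rewrite f1' /=; last by lia.
  by rewrite f1 ?b0 /= ?mulr1 ?mul0r ?addr0 //; lia.
have d1 : d = 1.
  have := gE (Ordinal yi); rewrite g1' /=; last by lia.
  by rewrite f0 ?g1 /= ?mulr0 ?mulr1 ?add0r //; lia.
have c0 : c = 0.
  have := gE (Ordinal xi); rewrite gx' /=; try lia.
  by rewrite f1 ?gx /= ?mulr0 ?mulr1 ?addr0 //; lia.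
split; apply/ffunP=> i.
  by rewrite fE a1 b0 mul1r mul0r addr0.
by rewrite gE c0 d1 mul1r mul0r add0r.
Qed.

(** The last nonzero coordinate of v marks the smallest flag space containing
    v. *)
Lemma lead_flag v k : v != 0 -> v \in flag e k -> (k <= m)%N ->
  (forall n, v \in flag e n -> (k <= n)%N) ->
  exists2 i : 'I_m, k = i.+1 & coord e i v != 0.
Proof.
move=> v0 vk km mink; case: k vk km mink => [|k] vk km mink.
  by move: vk v0; rewrite /flag take0 span_nil memv0 => ->.
exists (Ordinal km) => //; apply/eqP=> vk0.
suff /mink : v \in flag e k by rewrite ltnn.
apply/(flagP he) => i; rewrite leq_eqVlt => /predU1P[ki|ki].
  by rewrite -vk0; congr (coord _ _ _); apply: val_inj.
by move/(flagP he): vk; apply.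
Qed.

(** The first row is found in the smallest flag space that meets W, which is why
    its pivot is at most that of the Schubert cycle; the second one is any other
    vector of W, made to vanish at the first pivot. *)
Lemma echelon_exists U W : schubert_union e U W ->
  exists p (f g : row),
  [/\ p \in union_grid U, (f, g) \in echelon p & W = row_span (f, g)].
Proof.
case/exists_inP=> -[a b] abU /and3P[/= /eqP dW capW Wb].
have exx : exists k, (1 <= \dim (W :&: flag e k))%N by exists (val a).
case: (ex_minnP exx) => kx capx minx.
have [u [u0 uW ux]] := cap_flag_neq0 capx.
have minu n : u \in flag e n -> (kx <= n)%N.
  move=> un; apply: minx; rewrite lt0n dimv_eq0; apply/eqP=> cap0.
  have : u \in (W :&: flag e n)%VS by rewrite memv_cap uW.
  by rewrite cap0 memv0 (negbTE u0).
have kxa := minx a capW; have am := ltn_ord a; have bm := ltn_ord b.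
have [ix kxE ux0] := lead_flag u0 ux (leq_trans kxa (ltn_ord a : _ <= m)%N) minu.
pose u1 := (coord e ix u)^-1 *: u.
have u1W : u1 \in W by rewrite memvZ.
have u1x : u1 \in flag e kx by rewrite memvZ.
have u1x1 : coord e ix u1 = 1 by rewrite linearZ /= mulVf.
have : ~~ (W <= <[u1]>)%VS.
  apply/negP=> /dimvS; rewrite dW dim_vline; by case: (u1 != 0).
case/subvPn=> v vW vu.
pose v1 := v - coord e ix v *: u1.
have v1W : v1 \in W by rewrite memvB ?memvZ.
have v1x : coord e ix v1 = 0 by rewrite linearB linearZ /= u1x1 mulr1 subrr.
have v10 : v1 != 0.
  apply: contra vu; rewrite subr_eq0 => /eqP ->; exact/memvZ/memv_line.
have exy : exists k, v1 \in flag e k by exists (val b); apply: (subvP Wb).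
case: (ex_minnP exy) => ky vy miny.
have kyb : (ky <= b)%N by apply/miny/(subvP Wb).
have [iy kyE vy0] := lead_flag v10 vy (leq_trans kyb (ltn_ord b : _ <= m)%N) miny.
pose v2 := (coord e iy v1)^-1 *: v1.
have v2W : v2 \in W by rewrite memvZ.
have v2y : v2 \in flag e ky by rewrite memvZ.
have xy : (ix < iy)%N.
  have : (kx <= ky)%N.
    apply: minx; rewrite lt0n dimv_eq0; apply/eqP=> cap0.
    have : v1 \in (W :&: flag e ky)%VS by rewrite memv_cap v1W.
    by rewrite cap0 memv0 (negbTE v10).
  rewrite kxE kyE ltnS leq_eqVlt => /predU1P[/val_inj ixy|//].
  by move: vy0; rewrite -ixy v1x eqxx.
pose p : 'I_m.+1 * 'I_m.+1 := (inord ix.+1, inord iy.+1).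
have pE : (p.1 = ix.+1 :> nat) * (p.2 = iy.+1 :> nat).
  by rewrite /= !inordK // ltnS.
have pG : p \in grid m by rewrite inE !pE.
exists p, (row_of u1), (row_of v2).
have pe : (row_of u1, row_of v2) \in echelon p.
  apply/echelonP; split=> i; rewrite !pE ffunE.
  - by case=> /val_inj ->.
  - by move=> xi; move/(flagP he): u1x; apply; rewrite kxE.
  - by case=> /val_inj ->; rewrite linearZ /= mulVf.
  - by move=> yi; move/(flagP he): v2y; apply; rewrite kyE.
  - by case=> /val_inj -> _; rewrite linearZ /= v1x mulr0.
split=> //.
  by apply/union_gridP; exists (a, b); rewrite // inE pG !pE -kxE -kyE kxa.
have := echelon_free pG pe; rewrite /row_span /= !vec_row_of => fuv.
by rewrite (span2_eq dW fuv).
Qed.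

Lemma row_span_union U p (f g : row) :
  p \in union_grid U -> (f, g) \in echelon p ->
  schubert_union e U (row_span (f, g)).
Proof.
move=> pU fg; have pG := union_grid_sub pU.
have /union_gridP[[a b] abU] := pU; rewrite inE pG /= => /andP[pa pb].
have xy : (p.1 < p.2)%N by move: pG; rewrite inE => /andP[].
apply/exists_inP; exists (a, b) => //; apply: span2_cycle.
- exact: echelon_free fg.
- apply/(flagP he) => i ai; rewrite coord_row.
  by case/echelonP: fg => _ f0 _ _ _; apply: f0; lia.
- apply/(flagP he) => i ai; rewrite coord_row.
  by case/echelonP: fg => _ f0 _ _ _; apply: f0; lia.
- apply/(flagP he) => i ai; rewrite coord_row.
  by case/echelonP: fg => _ _ _ g0 _; apply: g0; lia.
Qed.

(** Each plane of the union is the span of exactly one pair of rows in echelon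
    form whose pivots are a point of the grid. *)
Lemma npointsE U :
  npoints e U = (\sum_(p in union_grid U) #|F| ^ (p.1 + p.2 - 3))%N.
Proof.
pose Z := [set z : ('I_m.+1 * 'I_m.+1) * (row * row) |
  (z.1 \in union_grid U) && (z.2 \in echelon z.1)].
have ZE z : (z \in Z) = (z.1 \in union_grid U) && (z.2 \in echelon z.1).
  by rewrite inE.
transitivity #|(fun z : ('I_m.+1 * 'I_m.+1) * (row * row) => row_span z.2) @: Z|.
  apply: eq_card => W; rewrite inE; apply/idP/imsetP.
    case/echelon_exists=> p [f [g [pU fg ->]]].
    by exists (p, (f, g)); rewrite // ZE /= pU.
  case=> -[p [f g]]; rewrite ZE /= => /andP[pU fg] ->.
    exact: row_span_union fg.
rewrite card_in_imset; last first.
  move=> [p [f g]] [p' [f' g']].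
  rewrite !ZE /= => /andP[pU fg] /andP[pU' fg'] eqW.
  have pG := union_grid_sub pU; have pG' := union_grid_sub pU'.
  have [] := echelon_sub pG pG' fg fg' _; first by rewrite -eqW.
  have [] := echelon_sub pG' pG fg' fg _; first by rewrite eqW.
  move=> y1 x1 y2 x2.
  have yE : p.2 = p'.2 by apply/val_inj/eqP; rewrite eqn_leq y1.
  have [{}x1 _] := x1 (esym yE); have [{}x2 eqfg] := x2 yE.
  have xE : p.1 = p'.1 by apply/val_inj/eqP; rewrite eqn_leq x1.
  have [-> ->] := eqfg xE.
  by rewrite (surjective_pairing p) (surjective_pairing p') xE yE.
rewrite -sum1_card (eq_bigl _ _ ZE).
rewrite -(pair_big_dep (fun p => p \in union_grid U) (fun p z => z \in echelon p)
  (fun _ _ => 1%N)) /=.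
by apply: eq_bigr => p pU; rewrite sum1_card card_echelon // (union_grid_sub pU).
Qed.

End Count.

(** * The extremal Schubert unions *)

Theorem proposition5p3 (m : nat) (hm : (3 <= m)%N)
    (F : fieldType) (V : vectType F) (e : m.-tuple V)
    (he : basis_of fullv e)
    (K : nat) (hK : (K <= 'C(m, 2))%N)
    (U1 U2 : {set 'I_m.+1 * 'I_m.+1})
    (hU1 : maximal_in (in_unions e K) (@gt_M m) U1)
    (hU2 : minimal_in (in_unions e K) (@gt_M m) U2) :
  (maximal_in (in_unions e K) (@gt_g m) U1 \/
   maximal_in (in_unions e K) (@gt_g m) U2) /\
  (forall U : {set 'I_m.+1 * 'I_m.+1}, U = U1 \/ U = U2 ->
     maximal_in (in_unions e K) (@gt_g m) U ->
     exists q0 : nat,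
       forall (Fq : finFieldType) (Vq : vectType Fq) (eb : m.-tuple Vq),
         basis_of fullv eb -> (q0 <= #|Fq|)%N ->
         forall U' : {set 'I_m.+1 * 'I_m.+1}, in_unions e K U' ->
           (npoints eb U' <= npoints eb U)%N).
Proof.
split; last first.
  move=> U _ [_ maxU]; exists (grid_bound m).+1 => Fq Vq eb heb qbig U' U'K.
  rewrite !npointsE // leqNgt; apply/negP=> lt.
  exact: (maxU U' U'K) (proj2 (gt_gP U U' qbig) lt).
have strict U : in_unions e K U -> strict_partition m.-1 K (Mseq U).
  by case=> _ /(has_spanning_dimE he) <-; apply: Mseq_strict.
have realized s : strict_partition m.-1 K s ->
    exists2 U, in_unions e K U & Mseq U = s.
  case/strict_realized=> U [Ug UK Us]; exists U => //; split=> //.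
  exact/(has_spanning_dimE he).
have [U1K maxU1] := hU1; have [U2K minU2] := hU2.
have KT := strict_leq (strict _ U1K).
have M1 : Mseq U1 = greedy m.-1 K.
  case: (greedy_max (strict _ U1K)) => // gt.
  have [U UK Us] := realized _ (greedy_strict KT).
  by case: (maxU1 U UK); rewrite /gt_M Us.
have M2 : Mseq U2 = frugal m.-1 K.
  case: (frugal_min (strict _ U2K)) => // gt.
  have [U UK Us] := realized _ (frugal_strict KT).
  by case: (minU2 U UK); rewrite /gt_M Us.
(* Large enough for both gt_gP and partition_bound. *)
pose q := (grid_bound m).+3.
have q3 : (2 < q)%N by [].
have qbig : (grid_bound m < q)%N by rewrite /q; lia.
have bound U : in_unions e K U ->
    (points q U <= maxn (points q U1) (points q U2))%N.
  move=> /strict/(partition_bound q3); rewrite -M1 -M2 !weight_Mseq; exact.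
have maximal W : in_unions e K W ->
    (forall U, in_unions e K U -> (points q U <= points q W)%N) ->
    maximal_in (in_unions e K) (@gt_g m) W.
  move=> WK best; split=> // U /best le /(gt_gP W U qbig).
  by rewrite ltnNge le.
have [le|/ltnW le] := leqP (points q U2) (points q U1).
  by left; apply: maximal => // U /bound; rewrite (maxn_idPl le).
by right; apply: maximal => // U /bound; rewrite (maxn_idPr le).
Qed.
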